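(* Consider the diagonal rapidity operators $\Lambda^3$ and $\Lambda^8$ of the SU(3) Haldane--Shastry model on $N$ sites. (a) If $N=3M$, $M_1=M_2=M$, with $M\ge1$ an integer, then $\Lambda^8|\Psi_0\rangle=0$. (b) If $N=3M-1$, $M\ge1$ an integer, $M_1=(N-2)/3$, $M_2=(N+1)/3$, then for $0\le n\le M_1$ $$\Lambda^8|\Psi_n\rangle=-\frac{\sqrt3}4\left(\frac{N-2}3-2n\right)|\Psi_n\rangle .$$ (c) If $N=3M-2$, $M\ge2$ an integer, $M_1=(N-4)/3$, $M_2=(N+2)/3$, then for $0\le n\le m\le M_1$ $$\Lambda^8|\Phi_{mn}\rangle=-\frac{\sqrt3}4\left(\frac{2N-8}3-2m-2n\right)|\Phi_{mn}\rangle .$$ In each of the cases (a), (b), (c), the state is also an eigenstate of $\Lambda^3$, with eigenvalue equal to $\sqrt3$ times its eigenvalue under $\Lambda^8$.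
   Context: The Hilbert space is $(\mathbb C^3)^{\otimes N}$, each site $\alpha=1,\dots,N$ having orthonormal basis b (blue), r (red), g (green). The sites are identified with the $N$-th roots of unity $\eta_\alpha=\exp(2\pi i\alpha/N)$. The colorflip operator $e_\alpha^{\sigma\tau}$ is the matrix unit $|\sigma\rangle\langle\tau|$ acting on site $\alpha$. The rapidity operators are $\Lambda^a=\frac12\sum_{\alpha\ne\beta}\frac{\eta_\alpha+\eta_\beta}{\eta_\alpha-\eta_\beta}f^{abc}J_\alpha^bJ_\beta^c$ (sum over $b,c=1,\dots,8$), where $J_\alpha^a=\frac12\sum_{\sigma\tau}\lambda^a_{\sigma\tau}e_\alpha^{\sigma\tau}$ with the Gell-Mann matrices $\lambda^a$ (color order b, r, g) and $f^{abc}$ defined by $[\lambda^a,\lambda^b]=2f^{abc}\lambda^c$ (so $f^{123}=i$). Explicitly, $$\Lambda^3=-\frac12\sum_{\alpha\ne\beta}^N\frac{\eta_\alpha+\eta_\beta}{\eta_\alpha-\eta_\beta}\left(e_\alpha^{\mathrm{br}}e_\beta^{\mathrm{rb}}+\tfrac12e_\alpha^{\mathrm{bg}}e_\beta^{\mathrm{gb}}-\tfrac12e_\alpha^{\mathrm{rg}}e_\beta^{\mathrm{gr}}\right),$$ $$\Lambda^8=-\frac{\sqrt3}4\sum_{\alpha\ne\beta}^N\frac{\eta_\alpha+\eta_\beta}{\eta_\alpha-\eta_\beta}\left(e_\alpha^{\mathrm{bg}}e_\beta^{\mathrm{gb}}+e_\alpha^{\mathrm{rg}}e_\beta^{\mathrm{gr}}\right).$$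 A wave function $\Psi[z_1,\dots,z_{M_1};w_1,\dots,w_{M_2}]$, symmetric in the $z_i$ and symmetric in the $w_k$, represents the state $$|\Psi\rangle=\sum_{\{z_i,w_k\}}\Psi[z_i;w_k]\;e_{z_1}^{\mathrm{bg}}\cdots e_{z_{M_1}}^{\mathrm{bg}}e_{w_1}^{\mathrm{rg}}\cdots e_{w_{M_2}}^{\mathrm{rg}}|0_{\mathrm g}\rangle,$$ where $|0_{\mathrm g}\rangle$ is the state with every site green, and the sum is over all ways of placing the blue particles $\{z_i\}$ and red particles $\{w_k\}$ on pairwise distinct sites of the lattice $\{\eta_1,\dots,\eta_N\}$. The wave functions are $$\Psi_0[z_i;w_k]=\prod_{i<j}^{M_1}(z_i-z_j)^2\prod_{k<l}^{M_2}(w_k-w_l)^2\prod_{i=1}^{M_1}\prod_{k=1}^{M_2}(z_i-w_k)\prod_{i=1}^{M_1}z_i\prod_{k=1}^{M_2}w_k,$$ $$\Psi_n=\frac1N\sum_{\gamma=1}^N(\bar\eta_\gamma)^n\prod_{i=1}^{M_1}(\eta_\gamma-z_i)\,\Psi_0,\qquad \Psi_{mn}=\frac1{N^2}\sum_{\gamma,\delta=1}^N(\bar\eta_\gamma)^m(\bar\eta_\delta)^n\prod_{i=1}^{M_1}(\eta_\gamma-z_i)(\eta_\delta-z_i)\,\Psi_0,$$ $$\Phi_{mn}=\sum_{\ell=0}^{\ell_{\mathrm m}}a^{mn}_\ell\Psi_{m+\ell,n-\ell},\qquad \ell_{\mathrm m}=\min(M_1-m,n),$$ with $a_0^{mn}=1$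 and $a_\ell^{mn}=\frac{(\ell-\frac53)(m-n+\ell-1)(m-n+2\ell)}{\ell(m-n+\ell+\frac23)(m-n+2\ell-2)}a_{\ell-1}^{mn}$ for $\ell\ge1$ (for $m=n$, $\ell=1$ this is read as $a_1^{mm}=-\frac45$). In each case $N,M_1,M_2$ take the values given in the claim. *)

(* Defs.v *)
From HB Require Import structures.
From mathcomp Require Import all_boot all_order all_algebra.
From mathcomp Require Import complex ring.
From mathcomp Require Import reals trigo.

Set Implicit Arguments.
Unset Strict Implicit.
Unset Printing Implicit Defensive.

Import Order.TTheory GRing.Theory Num.Theory.
Local Open Scope ring_scope.

(* Colors, in the order b, r, g used for the rows of the Gell-Mann matrices. *)
Notation color := 'I_3.
Definition blue : color := @Ordinal 3 0 isT.
Definition red : color := @Ordinal 3 1 isT.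
Definition green : color := @Ordinal 3 2 isT.

Notation config N := {ffun 'I_N -> color}.

(* The N-fold tensor power of C^3, written in coordinates: the value of a
   vector at a configuration c is its component along the product basis
   state |c_1> (x) ... (x) |c_N>. *)
Notation hilbert R N := {ffun config N -> R[i]^o}.

Definition recolor (N : nat) (c : config N) (alpha : 'I_N) (s : color) :
    config N :=
  [ffun x => if x == alpha then s else c x].

Section Model.
Variable R : realType.
Local Notation C := R[i].

Definition basis_state (N : nat) (c : config N) : hilbert R N :=
  [ffun c' => (c' == c)%:R].

(* The index alpha : 'I_N stands for site number alpha.+1. *)
Definition root_site (N : nat) (alpha : 'I_N) : C :=
  let t : R := 2 * pi * alpha.+1%:R / N%:R in (cos t +i* sin t)%C.

(* The matrix unit |s><t| on site alpha, in coordinates: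
   <c| e_alpha^{st} |v> = [c_alpha = s] <c with c_alpha replaced by t | v>. *)
Definition colorflip_fun (N : nat) (alpha : 'I_N) (s t : color)
    (v : hilbert R N) : hilbert R N :=
  [ffun c : config N => if c alpha == s then v (recolor c alpha t) else 0].

Fact colorflip_fun_is_linear N (alpha : 'I_N) s t :
  linear (colorflip_fun alpha s t).
Proof.
move=> a u v; apply/ffunP => c; rewrite !ffunE.
by case: ifP => // _; rewrite ?scaler0 ?addr0.
Qed.

HB.instance Definition _ N (alpha : 'I_N) s t :=
  GRing.isLinear.Build C (hilbert R N) (hilbert R N) _ (colorflip_fun alpha s t)
    (colorflip_fun_is_linear alpha s t).

Definition colorflip (N : nat) (alpha : 'I_N) (s t : color) :
    'End(hilbert R N) :=
  linfun (colorflip_fun alpha s t).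

Lemma colorflipE N (alpha : 'I_N) s t v c :
  colorflip alpha s t v c =
  if c alpha == s then v (recolor c alpha t) else 0.
Proof. by rewrite lfunE ffunE. Qed.

Lemma colorflip_basis N (alpha : 'I_N) s t (c : config N) :
  colorflip alpha s t (basis_state c) =
  if c alpha == t then basis_state (recolor c alpha s) else 0.
Proof.
apply/ffunP => d; rewrite colorflipE !ffunE.
have -> : (recolor d alpha t == c) =
    (c alpha == t) && [forall x, (x == alpha) || (d x == c x)].
  apply/eqP/andP => [<-|[/eqP ct /forallP dc]].
    rewrite ffunE eqxx; split=> //; apply/forallP => x.
    by rewrite ffunE; case: (x == alpha) => /=.
  apply/ffunP => x; rewrite ffunE; have := dc x.
  by case: eqP => [->|_ /eqP //].
case: (c alpha == t); rewrite ?ffunE /=; last by rewrite mulr0n if_same.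
have -> : (d == recolor c alpha s) =
    (d alpha == s) && [forall x, (x == alpha) || (d x == c x)].
  apply/eqP/andP => [->|[/eqP ds /forallP dc]].
    rewrite ffunE eqxx; split=> //; apply/forallP => x.
    by rewrite ffunE; case: (x == alpha) => /=.
  apply/ffunP => x; rewrite ffunE; have := dc x.
  by case: eqP => [->|_ /eqP].
by case: (d alpha == s).
Qed.

Definition gellmann (a : nat) : 'M[C]_3 :=
  let E s t : 'M[C]_3 := delta_mx s t in
  match a with
  | 1 => E blue red + E red blue
  | 2 => - 'i *: E blue red + 'i *: E red blue
  | 3 => E blue blue - E red red
  | 4 => E blue green + E green blue
  | 5 => - 'i *: E blue green + 'i *: E green blue
  | 6 => E red green + E green red
  | 7 => - 'i *: E red green + 'i *: E green red
  | 8 => (sqrtC 3)^-1 *: (E blue blue + E red red - 2 *: E green green)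
  | _ => 0
  end.

Fact sum18 (V : nmodType) (F : nat -> V) :
  \sum_(1 <= c < 9) F c =
  F 1%N + (F 2%N + (F 3%N + (F 4%N + (F 5%N + (F 6%N + (F 7%N + F 8%N)))))).
Proof. by rewrite unlock /= addr0. Qed.

Fact color_ind (P : color -> Prop) :
  P blue -> P red -> P green -> forall s, P s.
Proof.
by move=> Pb Pr Pg [[|[|[|//]]] h]; [move: Pb|move: Pr|move: Pg];
  congr (P _); apply: val_inj.
Qed.

Fact sum_color (V : nmodType) (F : color -> V) :
  \sum_s F s = F blue + F red + F green.
Proof.
rewrite !big_ord_recr big_ord0 /= add0r.
by congr (_ + _ + _); congr F; apply: val_inj.
Qed.

Fact gellmannE (X : 'M[C]_3) (c : nat) :
  \tr (X *m gellmann c) =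
  match c with
  | 1 => X red blue + X blue red
  | 2 => - 'i * X red blue + 'i * X blue red
  | 3 => X blue blue - X red red
  | 4 => X green blue + X blue green
  | 5 => - 'i * X green blue + 'i * X blue green
  | 6 => X green red + X red green
  | 7 => - 'i * X green red + 'i * X red green
  | 8 => (sqrtC 3)^-1 * (X blue blue + X red red - 2 * X green green)
  | _ => 0
  end.
Proof.
rewrite /mxtrace sum_color !mxE !sum_color.
case: c => [|[|[|[|[|[|[|[|[|c]]]]]]]]]; rewrite /gellmann !mxE /=;
  move: (X _ _) (X _ _) (X _ _) (X _ _) (X _ _) (X _ _) (X _ _) (X _ _) (X _ _);
  move: (sqrtC 3 : C) ('i : C) => q I *; ring.
Qed.

Lemma gellmann_complete (X : 'M[C]_3) :
  \tr X = 0 -> X = \sum_(1 <= c < 9) (\tr (X *m gellmann c) / 2) *: gellmann c.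
Proof.
move=> X0; have {}X0 : X green green = - (X blue blue + X red red).
  by apply/eqP; rewrite -addr_eq0 -[eqbRHS]X0 /mxtrace sum_color addrC.
have hI u v s t : (- 'i * u + 'i * v) / 2 * (- 'i * s + 'i * t) =
    (v - u) * (s - t) / 2 :> C.
  have i2 : 'i * 'i = -1 :> C by rewrite -expr2 sqrCi.
  transitivity (- ('i * 'i) * ((v - u) * (s - t) / 2) : C); first by ring.
  by rewrite i2 opprK mul1r.
have hq u v : (sqrtC 3)^-1 * u / 2 * ((sqrtC 3)^-1 * v) = u * v / 2 / 3 :> C.
  have s2 : (sqrtC 3)^-1 * (sqrtC 3)^-1 = 3^-1 :> C.
    by rewrite -expr2 exprVn sqrtCK.
  by rewrite -s2; ring.
under eq_bigr => c _ do rewrite gellmannE.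
rewrite sum18 X0.
apply/matrixP; apply: color_ind; apply: color_ind;
  rewrite ?X0 !mxE /= !hI !hq; clear;
  move: (X _ _) (X _ _) (X _ _) (X _ _) (X _ _) (X _ _) (X _ _) (X _ _).
all: rewrite ?(mulr0, mulr1, addr0, add0r, subr0, sub0r, oppr0, mul0r).
all: by move=> *; field.
Qed.

Lemma gellmann_orthogonal (a b : nat) :
  (0 < a < 9)%N -> (0 < b < 9)%N ->
  \tr (gellmann a *m gellmann b) = 2 * (a == b)%:R.
Proof.
have i2 : 'i * 'i = -1 :> C by rewrite -expr2 sqrCi.
have s2 : (sqrtC 3)^-1 * (sqrtC 3)^-1 = 3^-1 :> C.
  by rewrite -expr2 exprVn sqrtCK.
rewrite gellmannE.
case: a => [|[|[|[|[|[|[|[|[|a]]]]]]]]] // _;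
case: b => [|[|[|[|[|[|[|[|[|b]]]]]]]]] // _; rewrite !mxE /=;
  rewrite ?(mulr0, mulr1, addr0, add0r, subr0, sub0r, oppr0, mulrN, mulNr, i2,
            opprK, addNr, subrr) //.
have -> : (sqrtC 3)^-1 *
    ((sqrtC 3)^-1 + (sqrtC 3)^-1 + 2 * ((sqrtC 3)^-1 * 2)) =
    6 * ((sqrtC 3)^-1 * (sqrtC 3)^-1) :> C by ring.
by rewrite s2; field.
Qed.

(* Since tr(lambda^a lambda^b) = 2 delta_ab, this is the solution of
   [lambda^a, lambda^b] = 2 f^{abc} lambda^c; see commutator_gellmann and
   structure_const_unique. *)
Definition structure_const (a b c : nat) : C :=
  \tr ((gellmann a *m gellmann b - gellmann b *m gellmann a) *m gellmann c) / 4.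

Lemma commutator_gellmann (a b : nat) :
  gellmann a *m gellmann b - gellmann b *m gellmann a =
  2 *: \sum_(1 <= c < 9) structure_const a b c *: gellmann c.
Proof.
rewrite {1}[LHS]gellmann_complete; last by rewrite raddfB /= mxtrace_mulC subrr.
rewrite scaler_sumr; apply: eq_bigr => c _; rewrite scalerA; congr (_ *: _).
rewrite /structure_const; have -> : 4 = 2 * 2 :> C by rewrite -natrM.
by rewrite invfM mulrCA mulVKf ?pnatr_eq0.
Qed.

Lemma structure_const_unique (a b : nat) (f : nat -> C) :
  gellmann a *m gellmann b - gellmann b *m gellmann a =
    2 *: \sum_(1 <= c < 9) f c *: gellmann c ->
  forall c, (0 < c < 9)%N -> f c = structure_const a b c.
Proof.
move=> abf c cP; rewrite /structure_const abf -scalemxAl mxtraceZ mulmx_suml.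
rewrite raddf_sum /= (bigD1_seq c) ?iota_uniq ?mem_index_iota //= big1_seq ?addr0 => [|d].
  rewrite -scalemxAl mxtraceZ gellmann_orthogonal // eqxx mulr1.
  have -> : 4 = 2 * 2 :> C by rewrite -natrM.
  by rewrite mulrCA mulfK // mulf_eq0 ?pnatr_eq0.
case/andP=> dc; rewrite mem_index_iota => dP.
by rewrite -scalemxAl mxtraceZ gellmann_orthogonal // (negbTE dc) !mulr0.
Qed.
Definition Jspin (N : nat) (alpha : 'I_N) (a : nat) : 'End(hilbert R N) :=
  2^-1 *: \sum_(s : color) \sum_(t : color)
            gellmann a s t *: colorflip alpha s t.

Definition rapidity (N : nat) (a : nat) : 'End(hilbert R N) :=
  2^-1 *: \sum_(alpha < N) \sum_(beta < N | alpha != beta)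
    ((root_site alpha + root_site beta) /
     (root_site alpha - root_site beta)) *:
      \sum_(1 <= b < 9) \sum_(1 <= c < 9)
        structure_const a b c *: (Jspin alpha b \o Jspin beta c)%VF.

(* For a diagonal Gell-Mann matrix the double sum over b and c collapses by the
   completeness relation; rapidity3E and rapidity8E are the resulting explicit
   forms of the two diagonal rapidity operators. *)
Fact colorflipC N (alpha beta : 'I_N) (s t u v : color) :
  alpha != beta ->
  (colorflip alpha s t \o colorflip beta u v =
   colorflip beta u v \o colorflip alpha s t)%VF.
Proof.
move=> ab; apply/lfunP => x; apply/ffunP => c.
have ba : (beta == alpha) = false by rewrite eq_sym (negbTE ab).
rewrite !comp_lfunE !colorflipE !ffunE (negbTE ab) ba.
case: ifP => // _; case: ifP => // _; congr (x _); apply/ffunP => y.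
by rewrite !ffunE; have [->|//] := eqVneq y beta; rewrite ba.
Qed.

Definition pairing (N : nat) (s t : color) : 'End(hilbert R N) :=
  \sum_(alpha < N) \sum_(beta < N | alpha != beta)
    ((root_site alpha + root_site beta) / (root_site alpha - root_site beta)) *:
      (colorflip alpha s t \o colorflip beta t s)%VF.

Fact pairingC N (s t : color) : pairing N t s = - pairing N s t.
Proof.
rewrite [LHS](exchange_big_dep predT) //.
rewrite /pairing.
rewrite -[RHS]sumrN.
apply: eq_bigr => alpha _.
rewrite -[RHS]sumrN.
apply: eq_big => [beta|beta ba]; first by rewrite eq_sym.
rewrite colorflipC // -scaleNr; congr (_ *: _).
by rewrite -opprB invrN mulrN addrC.
Qed.

Definition site_op (N : nat) (alpha : 'I_N) (X : 'M[C]_3) : 'End(hilbert R N) :=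
  \sum_(s : color) \sum_(t : color) X s t *: colorflip alpha s t.

Fact site_op_is_linear N (alpha : 'I_N) : linear (site_op alpha).
Proof.
move=> a X Y; rewrite /site_op scaler_sumr -big_split; apply: eq_bigr => s _.
rewrite scaler_sumr -big_split; apply: eq_bigr => t _ /=.
by rewrite !mxE scalerDl scalerA.
Qed.

Fact site_opZ N (alpha : 'I_N) (k : C) (X : 'M[C]_3) :
  site_op alpha (k *: X) = k *: site_op alpha X.
Proof.
rewrite /site_op scaler_sumr; apply: eq_bigr => s _.
by rewrite scaler_sumr; apply: eq_bigr => t _; rewrite mxE scalerA.
Qed.

Fact site_op_sum N (alpha : 'I_N) (r : seq nat) (f : nat -> C)
    (X : nat -> 'M[C]_3) :
  site_op alpha (\sum_(c <- r) f c *: X c) =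
  \sum_(c <- r) f c *: site_op alpha (X c).
Proof.
elim: r => [|c r IH].
  rewrite !big_nil /site_op big1 // => s _; rewrite big1 // => t _.
  by rewrite mxE scale0r.
by rewrite !big_cons site_op_is_linear IH.
Qed.

Fact site_op_delta N (alpha : 'I_N) (s t : color) :
  site_op alpha (delta_mx s t) = colorflip alpha s t.
Proof.
rewrite /site_op (bigD1 s) //= [X in _ + X]big1 => [|i si].
  rewrite (bigD1 t) //= [X in _ + X + _]big1 => [|j tj].
    by rewrite mxE !eqxx scale1r !addr0.
  by rewrite mxE (negbTE tj) andbF scale0r.
by apply: big1 => j _; rewrite mxE (negbTE si) scale0r.
Qed.

Fact gellmann_fierz (u v : color) :
  u != v ->
  \sum_(1 <= b < 9) gellmann b u v *: gellmann b = 2 *: delta_mx v u.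
Proof.
move=> uv; have t0 : \tr (delta_mx v u : 'M[C]_3) = 0.
  rewrite /mxtrace big1 // => i _; rewrite mxE.
  by case: eqVneq => //= ->; rewrite eq_sym (negbTE uv).
rewrite [in RHS](gellmann_complete t0) scaler_sumr; apply: eq_bigr => b _.
rewrite scalerA; congr (_ *: _); rewrite mxtrace_mulC mulrC divfK ?pnatr_eq0 //.
rewrite /mxtrace (bigD1 u) //= big1 ?addr0 => [|i iu].
  rewrite mxE (bigD1 v) //= big1 ?addr0 => [|j jv]; rewrite mxE ?eqxx ?mulr1 //.
  by rewrite (negbTE jv) mulr0.
by rewrite mxE big1 // => j _; rewrite mxE (negbTE iu) andbF mulr0.
Qed.

Fact exchange_scaled_sums (V : lmodType C) n (P : rel 'I_n)
    (th : 'I_n -> 'I_n -> C) (k : C) (D : color -> color -> C)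
    (F : 'I_n -> 'I_n -> color -> color -> V) :
  \sum_x \sum_(y | P x y) th x y *: (k *: \sum_s \sum_t D s t *: F x y s t) =
  k *: \sum_s \sum_t D s t *: \sum_x \sum_(y | P x y) th x y *: F x y s t.
Proof.
transitivity (\sum_x \sum_s \sum_t \sum_(y | P x y)
    (k * D s t * th x y) *: F x y s t).
  apply: eq_bigr => x _; rewrite [RHS](eq_bigr (fun s => \sum_(y | P x y)
    \sum_t (k * D s t * th x y) *: F x y s t)) => [|s _]; last first.
    by rewrite exchange_big.
  rewrite exchange_big; apply: eq_bigr => y _ /=.
  rewrite !scaler_sumr; apply: eq_bigr => s _.
  rewrite !scaler_sumr; apply: eq_bigr => t _.
  by rewrite !scalerA; congr (_ *: _); ring.
rewrite exchange_big scaler_sumr; apply: eq_bigr => s _ /=.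
rewrite exchange_big scaler_sumr; apply: eq_bigr => t _ /=.
rewrite !scaler_sumr; apply: eq_bigr => x _.
by rewrite !scaler_sumr; apply: eq_bigr => y _; rewrite !scalerA.
Qed.

Fact combine_sums (V : lmodType C) n (P : rel 'I_n)
    (th : 'I_n -> 'I_n -> C) (k1 k2 k3 : C) (F G H : 'I_n -> 'I_n -> V) :
  \sum_x \sum_(y | P x y)
    th x y *: (k1 *: F x y + k2 *: G x y + k3 *: H x y) =
  k1 *: (\sum_x \sum_(y | P x y) th x y *: F x y) +
  k2 *: (\sum_x \sum_(y | P x y) th x y *: G x y) +
  k3 *: (\sum_x \sum_(y | P x y) th x y *: H x y).
Proof.
rewrite !scaler_sumr -!big_split; apply: eq_bigr => x _ /=.
rewrite !scaler_sumr -!big_split; apply: eq_bigr => y _ /=.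
by rewrite !scalerDr !scalerA ![th x y * _]mulrC.
Qed.

Fact rapidity_diag N (a : nat) (d : color -> C) :
  (forall s t, gellmann a s t = (s == t)%:R * d s) ->
  rapidity N a =
    8^-1 *: \sum_(s : color) \sum_(t : color) (d t - d s) *: pairing N s t.
Proof.
move=> ad.
have comm b : gellmann a *m gellmann b - gellmann b *m gellmann a =
    \matrix_(u, v) ((d u - d v) * gellmann b u v).
  have -> : gellmann a = diag_mx (\row_s d s).
    apply/matrixP => s t; rewrite ad !mxE mulr_natl.
    by case: eqVneq => [->|].
  rewrite mul_diag_mx mul_mx_diag; apply/matrixP => u v; rewrite !mxE.
  by rewrite mulrBl [_ * d v]mulrC.
have sumr I (r : seq I) (F : I -> 'End(hilbert R N)) (A : 'End(hilbert R N)) :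
    (A \o \sum_(i <- r) F i = \sum_(i <- r) (A \o F i))%VF.
  by apply: (big_morph (comp_lfun A)) => [f g|];
    [exact: comp_lfunDr|exact: comp_lfun0r].
have suml I (r : seq I) (F : I -> 'End(hilbert R N)) (A : 'End(hilbert R N)) :
    ((\sum_(i <- r) F i) \o A = \sum_(i <- r) (F i \o A))%VF.
  by apply: (big_morph (fun f => (f \o A)%VF)) => [f g|];
    [exact: comp_lfunDl|exact: comp_lfun0l].
have inner (alpha beta : 'I_N) b :
    \sum_(1 <= c < 9)
       structure_const a b c *: (Jspin alpha b \o Jspin beta c)%VF =
    8^-1 *: \sum_u \sum_v ((d u - d v) * gellmann b u v) *:
       (site_op alpha (gellmann b) \o colorflip beta u v)%VF.
  have -> : \sum_(1 <= c < 9)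
       structure_const a b c *: (Jspin alpha b \o Jspin beta c)%VF =
     8^-1 *: (site_op alpha (gellmann b) \o
        site_op beta (2 *: \sum_(1 <= c < 9) structure_const a b c *: gellmann c))%VF.
    rewrite site_opZ site_op_sum -comp_lfunZr sumr scalerA scaler_sumr.
    apply: eq_bigr => c _; rewrite -comp_lfunZr scalerA.
    have JE x k : Jspin x k = 2^-1 *: site_op x (gellmann k) by [].
    rewrite !JE -comp_lfunZl -comp_lfunZr !scalerA; congr (_ *: _).
    have -> : 8^-1 * 2 = 2^-1 / 2 :> C.
      have -> : 8 = 2 * (2 * 2) :> C by rewrite -!natrM.
      by rewrite invfM mulrAC mulVf ?pnatr_eq0 // mul1r invfM.
    by rewrite -mulrA mulrC.
  rewrite -commutator_gellmann comm; congr (_ *: _); rewrite {2}/site_op sumr.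
  apply: eq_bigr => u _; rewrite sumr; apply: eq_bigr => v _.
  by rewrite mxE -comp_lfunZr.
have pairE (alpha beta : 'I_N) :
    \sum_(1 <= b < 9) \sum_(1 <= c < 9)
       structure_const a b c *: (Jspin alpha b \o Jspin beta c)%VF =
    4^-1 *: \sum_s \sum_t (d t - d s) *:
       (colorflip alpha s t \o colorflip beta t s)%VF.
  under eq_bigr => b _ do rewrite inner.
  rewrite -scaler_sumr exchange_big /= [in RHS]exchange_big /=.
  rewrite !scaler_sumr; apply: eq_bigr => u _.
  rewrite exchange_big /= !scaler_sumr; apply: eq_bigr => v _.
  have [->|uv] := eqVneq u v.
    rewrite subrr scale0r !scaler0 big1 ?scaler0 // => b _.
    by rewrite mul0r scale0r.
  under eq_bigr => b _ do rewrite -scalerA comp_lfunZl.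
  rewrite -scaler_sumr -suml (_ : \sum_(1 <= b < 9) _ =
      2 *: colorflip alpha v u); last first.
    rewrite -(site_op_sum alpha _ (fun b => gellmann b u v) gellmann).
    by rewrite (congr1 (site_op alpha) (gellmann_fierz uv)) site_opZ site_op_delta.
  rewrite -comp_lfunZl !scalerA; congr (_ *: _).
  have -> : 8 = 4 * 2 :> C by rewrite -!natrM.
  by rewrite invfM -mulrA [_ * 2]mulrC mulKf ?pnatr_eq0.
rewrite /rapidity.
under eq_bigr => alpha _ do under eq_bigr => beta _ do rewrite pairE.
have -> : 8 = 2 * 4 :> C by rewrite -natrM.
rewrite invfM -scalerA; congr (_ *: _).
exact: exchange_scaled_sums.
Qed.

Fact antisymmetric_sum (V : lmodType C) (d : color -> C)
    (G : color -> color -> V) :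
  (forall s t, G t s = - G s t) ->
  8^-1 *: (\sum_s \sum_t (d t - d s) *: G s t) =
  4^-1 *: ((d red - d blue) *: G blue red + (d green - d blue) *: G blue green +
           (d green - d red) *: G red green).
Proof.
move=> Gopp; rewrite !sum_color !subrr !scale0r.
rewrite (Gopp blue red) (Gopp blue green) (Gopp red green).
have opp (x y : C) (v : V) : (x - y) *: - v = (y - x) *: v.
  by rewrite scalerN -scaleNr opprB.
rewrite !opp.
have -> : 4^-1 = 8^-1 * 2 :> C.
  have -> : 8 = 4 * 2 :> C by rewrite -natrM.
  by rewrite invfM divfK ?pnatr_eq0.
rewrite -scalerA; congr (_ *: _); rewrite scaler_nat mulr2n.
move: (_ *: G blue red) (_ *: G blue green) (_ *: G red green) => x y z.
by rewrite add0r !addr0 (AC (2*2*2) ((1*2*4)*(3*5*6))).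
Qed.

Fact rapidity_diag_pairing N (a : nat) (d : color -> C) :
  (forall s t, gellmann a s t = (s == t)%:R * d s) ->
  rapidity N a =
    4^-1 *: ((d red - d blue) *: pairing N blue red +
             (d green - d blue) *: pairing N blue green +
             (d green - d red) *: pairing N red green).
Proof.
move=> ad; rewrite (rapidity_diag _ ad).
by apply: antisymmetric_sum => s t; exact: pairingC.
Qed.

Fact eq_combine (V : lmodType C) (k k' a b c a' b' c' : C) (x y z : V) :
  k * a = k' * a' -> k * b = k' * b' -> k * c = k' * c' ->
  k *: (a *: x + b *: y + c *: z) = k' *: (a' *: x + b' *: y + c' *: z).
Proof. by move=> ea eb ec; rewrite !scalerDr !scalerA ea eb ec. Qed.

Lemma rapidity3E N :
  rapidity N 3 = - 2^-1 *: \sum_(alpha < N) \sum_(beta < N | alpha != beta)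
    ((root_site alpha + root_site beta) /
     (root_site alpha - root_site beta)) *:
      ((colorflip alpha blue red \o colorflip beta red blue)%VF
       + 2^-1 *: (colorflip alpha blue green \o colorflip beta green blue)%VF
       - 2^-1 *: (colorflip alpha red green \o colorflip beta green red)%VF).
Proof.
pose d (s : color) : C := if s == blue then 1 else if s == red then -1 else 0.
rewrite (@rapidity_diag_pairing _ _ d) => [|s t]; last first.
  move: s t; apply: color_ind; apply: color_ind; rewrite /d !mxE /=;
  by rewrite ?(subr0, sub0r, subrr, oppr0, mul0r, mul1r).
rewrite /d /= sub0r sub0r opprK.
transitivity (- 2^-1 *: (1 *: pairing N blue red + 2^-1 *: pairing N blue green
                         + - 2^-1 *: pairing N red green)).
  have e4 : 4^-1 = 2^-1 / 2 :> C by rewrite -invfM -natrM.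
  apply: eq_combine; rewrite e4 -?[-1 - 1]opprD -?(natrD _ 1 1) ?mulrN ?mulNr
    ?mulr1 ?divfK ?pnatr_eq0 ?opprK //.
rewrite -[X in _ *: X = _]combine_sums; congr (_ *: _).
apply: eq_bigr => alpha _; apply: eq_bigr => beta _.
by rewrite scale1r scaleNr.
Qed.

Lemma rapidity8E N :
  rapidity N 8 =
  - (sqrtC 3 / 4) *: \sum_(alpha < N) \sum_(beta < N | alpha != beta)
    ((root_site alpha + root_site beta) /
     (root_site alpha - root_site beta)) *:
      ((colorflip alpha blue green \o colorflip beta green blue)%VF
       + (colorflip alpha red green \o colorflip beta green red)%VF).
Proof.
pose d (s : color) : C := (sqrtC 3)^-1 * (if s == green then -2 else 1).
rewrite (@rapidity_diag_pairing _ _ d) => [|s t]; last first.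
  move: s t; apply: color_ind; apply: color_ind; rewrite /d !mxE /=;
  by rewrite ?(mulr0, mulr1, mul0r, mul1r, addr0, add0r, subr0, sub0r, mulrN, oppr0).
rewrite /d /=.
transitivity (- (sqrtC 3 / 4) *: (0 *: pairing N blue red +
    1 *: pairing N blue green + 1 *: pairing N red green)).
  have q3 : sqrtC 3 = 3 * (sqrtC 3)^-1 :> C.
    apply: (canRL (mulfK _)); first by rewrite sqrtC_eq0 pnatr_eq0.
    by rewrite -expr2 sqrtCK.
  apply: eq_combine; first by rewrite subrr !mulr0.
    by rewrite [in RHS]q3; ring.
  by rewrite [in RHS]q3; ring.
rewrite -[X in _ *: X = _]combine_sums; congr (_ *: _).
apply: eq_bigr => alpha _; apply: eq_bigr => beta _.
by rewrite scale0r add0r !scale1r.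
Qed.

Definition wavefun (M1 M2 : nat) := ('I_M1 -> C) -> ('I_M2 -> C) -> C.

Definition increasing (n N : nat) (x : {ffun 'I_n -> 'I_N}) : bool :=
  [forall i : 'I_n, forall j : 'I_n, (i < j)%N ==> (x i < x j)%N].

(* The particles of one color are indistinguishable; each placement is listed
   once, labelling the particles of each color by increasing site number. For
   wave functions symmetric in the z's and in the w's the choice of labelling
   is immaterial. *)
Definition placement (M1 M2 N : nat)
    (p : {ffun 'I_M1 -> 'I_N} * {ffun 'I_M2 -> 'I_N}) : bool :=
  [&& increasing p.1, increasing p.2 & [forall i, forall k, p.1 i != p.2 k]].

Definition vacuum (N : nat) : hilbert R N := basis_state [ffun=> green].

Definition ket (N M1 M2 : nat) (Psi : wavefun M1 M2) : hilbert R N :=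
  \sum_(p : {ffun 'I_M1 -> 'I_N} * {ffun 'I_M2 -> 'I_N} | placement p)
    Psi (fun i => root_site (p.1 i)) (fun k => root_site (p.2 k)) *:
      ((\big[@comp_lfun _ _ _ _ / \1%VF]_(i < M1) colorflip (p.1 i) blue green) \o
       (\big[@comp_lfun _ _ _ _ / \1%VF]_(k < M2) colorflip (p.2 k) red green))%VF
        (vacuum N).

Definition Psi0 (M1 M2 : nat) : wavefun M1 M2 := fun z w =>
  (\prod_(i < M1) \prod_(j < M1 | (i < j)%N) (z i - z j) ^+ 2) *
  (\prod_(k < M2) \prod_(l < M2 | (k < l)%N) (w k - w l) ^+ 2) *
  (\prod_(i < M1) \prod_(k < M2) (z i - w k)) *
  (\prod_(i < M1) z i) * (\prod_(k < M2) w k).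

Definition Psi1 (N M1 M2 n : nat) : wavefun M1 M2 := fun z w =>
  N%:R^-1 *
  (\sum_(gamma < N)
     (root_site gamma)^* ^+ n * \prod_(i < M1) (root_site gamma - z i)) *
  Psi0 z w.

Definition Psi2 (N M1 M2 m n : nat) : wavefun M1 M2 := fun z w =>
  (N%:R ^+ 2)^-1 *
  (\sum_(gamma < N) \sum_(delta < N)
     (root_site gamma)^* ^+ m * (root_site delta)^* ^+ n *
     \prod_(i < M1) ((root_site gamma - z i) * (root_site delta - z i))) *
  Psi0 z w.

(* For m = n and l = 1 the recursion formula has a vanishing factor m - n both
   in the numerator and in the denominator; its value there is set to -4/5. *)
Fixpoint acoef (m n l : nat) : C :=
  match l with
  | 0 => 1
  | l'.+1 =>
    if (m == n) && (l' == 0%N) then - (4 / 5)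
    else
      let d : C := m%:R - n%:R in
      ((l%:R - 5 / 3) * (d + l%:R - 1) * (d + 2 * l%:R)) /
      (l%:R * (d + l%:R + 2 / 3) * (d + 2 * l%:R - 2)) * acoef m n l'
  end.

Definition Phi (N M1 M2 m n : nat) : wavefun M1 M2 := fun z w =>
  \sum_(0 <= l < (minn (M1 - m) n).+1)
    acoef m n l * Psi2 N (m + l) (n - l) z w.

Definition eigenstate (N : nat) (A : 'End(hilbert R N)) (x : C)
    (v : hilbert R N) : Prop :=
  v != 0 /\ A v = x *: v.

End Model.

(* Main.v *)
Require Import Defs.
From mathcomp Require Import all_boot all_order all_algebra all_fingroup.
From mathcomp Require Import complex ring lra zify.
From mathcomp Require Import reals trigo.

Set Implicit Arguments.
Unset Strict Implicit.
Unset Printing Implicit Defensive.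

Import Order.TTheory GRing.Theory Num.Theory.
Local Open Scope ring_scope.

(** For an N-th root of unity [z], the sum of [(z + y) / (z - y) * y ^+ s] over
    the other roots [y] is [(2 s - N) z ^+ s] when [0 < s < N]. In each of the
    three cases N = M1 + 2 M2, and the wave function is a homogeneous polynomial
    whose degree in every particle position lies between 1 and N - 1; hence the
    sum of the blue-green and red-green pairings acts on it as 2 deg - N (M1 + M2),
    which gives the eigenvalue of [Lambda^8].

    For [Lambda^3] it remains to see that the blue-red minus the red-green
    pairing has the same eigenvalue. This is the previous statement with red and
    green interchanged, because the state is an eigenvector, with eigenvalue
    (-1)^M2, of the global exchange of red and green: the product of the
    differences [w - y] from a site [w] to all other sites is [N / w], and
    multiplying this over all red, respectively all green, sites relates the two
    amplitudes. The only property of the coefficients [a_l] that matters is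
    [a_0 = 1], which ensures that the state does not vanish. *)

(** * Sums over the roots of unity *)

Section RootsOfUnity.
Variables (F : fieldType) (N : nat) (e : 'I_N -> F).
Hypotheses (e_unity : forall a, e a ^+ N = 1) (e_inj : injective e).

Let card_gt0 (a : 'I_N) : (0 < N)%N.
Proof. by apply: leq_ltn_trans (ltn_ord a). Qed.

Lemma unity_enum_neq0 a : e a != 0.
Proof.
apply: contra_eq_neq (e_unity a) => ->.
by rewrite expr0n -leqn0 leqNgt (card_gt0 a) eq_sym oner_neq0.
Qed.

(** Both sides are monic of degree [N] with the [N] distinct values of [e] as roots. The argument
    [a0] makes [N] positive; for [N = 0] the sides would be 1 and 0. *)
Lemma prod_unity_enum (a0 : 'I_N) : \prod_a ('X - (e a)%:P) = 'X^N - 1.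
Proof.
have N0 := card_gt0 a0.
rewrite [RHS](@all_roots_prod_XsubC _ _ (codom e)).
- by rewrite lead_coefXnsubC // scale1r big_map big_enum.
- by rewrite size_XnsubC // size_codom card_ord.
- by apply/allP => _ /codomP [a ->]; rewrite rootE !hornerE e_unity subrr.
- by rewrite uniq_rootsE; apply/injectiveP.
Qed.

Lemma unity_enum_surj (a0 : 'I_N) x : x ^+ N = 1 -> exists a, x = e a.
Proof.
move=> xN; have : root ('X^N - 1) x by rewrite rootE !hornerE xN subrr.
rewrite -(prod_unity_enum a0) -(big_map e predT (fun y => 'X - y%:P)).
by rewrite root_prod_XsubC => /mapP [a _ ->]; exists a.
Qed.

(** Differentiate [prod_unity_enum] and evaluate at [e a]: on the product side only the term that
    drops the factor of [a] survives. *)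
Lemma prod_unity_enum_diff a :
  e a * \prod_(b | b != a) (e a - e b) = N%:R.
Proof.
have /(congr1 (fun p => p^`().[e a])) := prod_unity_enum a.
rewrite (bigD1 a) //= derivM derivXsubC derivB derivXn derivC mul1r subr0.
rewrite !hornerE subrr mul0r addr0 hornerMn hornerXn horner_prod.
under eq_bigr => b _ do rewrite hornerXsubC.
move=> ->; rewrite mulrnAr -exprS prednK ?e_unity //.
exact: card_gt0 a.
Qed.

(** Turns a symmetry of the set of roots, such as a rotation or a reflection, into a reindexing of
    sums over sites. *)
Lemma unity_enum_reindex (f : F -> F) :
  (forall a, f (e a) ^+ N = 1) -> injective (f \o e) ->
  exists2 g : 'I_N -> 'I_N, injective g & forall a, f (e a) = e (g a).
Proof.
move=> f1 fi; have [g gE] := fin_all_exists (fun a => unity_enum_surj a (f1 a)).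
by exists g => // a b gab; apply: fi; rewrite /= !gE gab.
Qed.

(** As ['X^k - 1] has at most [k < N] roots, some [e a ^+ k] differs from 1; rotation by [e a]
    multiplies the sum by this factor and also permutes its terms. *)
Lemma sum_unity_enum k : (0 < k < N)%N -> \sum_a e a ^+ k = 0.
Proof.
case/andP=> k0 kN.
have [a ak] : exists a, e a ^+ k != 1.
  apply/existsP; apply: contraLR kN; rewrite negb_exists => /forallP ek.
  have p0 : 'X^k - 1 != 0 :> {poly F} by rewrite -size_poly_eq0 size_XnsubC.
  rewrite -leqNgt -ltnS -(size_XnsubC (1 : F) k0).
  rewrite -[X in (X < _)%N]card_ord -(size_codom e).
  apply: max_poly_roots p0 _ _; last by apply/injectiveP.
  apply/allP => _ /codomP [a ->]; rewrite rootE !hornerE subr_eq0.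
  by rewrite -[_ == _]negbK ek.
have [|b c /(mulfI (unity_enum_neq0 a)) /e_inj //|g gi gE] :=
    @unity_enum_reindex (fun x => e a * x).
  by move=> b; rewrite exprMn !e_unity mulr1.
apply/eqP; rewrite -(mulrI_eq0 _ (@mulfI _ (1 - e a ^+ k) _)) ?subr_eq0 1?eq_sym//.
rewrite mulrBl mul1r {1}(reindex_inj gi) /= mulr_sumr -sumrB big1 // => b _.
by rewrite -gE exprMn subrr.
Qed.

Definition hs_kernel (a b : 'I_N) : F := (e a + e b) / (e a - e b).

(** The reflection of [x] to [e a ^+ 2 / x] permutes the roots, fixes [e a] and changes the sign of
    the kernel, so the sum equals its own opposite. *)
Lemma sum_hs_kernel0 a : 2%:R != 0 :> F -> \sum_(b | b != a) hs_kernel a b = 0.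
Proof.
move=> F2; have ea := unity_enum_neq0 a.
have [||g gi gE] := @unity_enum_reindex (fun x => e a ^+ 2 / x).
- by move=> b; rewrite exprMn exprVn -exprM mulnC exprM !e_unity expr1n invr1 mulr1.
- by move=> b c /(mulfI (expf_neq0 2 ea)) /invr_inj /e_inj.
set T := \sum_(b | _) _; have : T = - T.
  rewrite {1}/T (reindex_inj gi) -sumrN.
  have ga b : (g b != a) = (b != a).
    congr (~~ _); rewrite -(inj_eq e_inj) -gE -(inj_eq e_inj).
    have eb := unity_enum_neq0 b.
    rewrite -(inj_eq (mulIf eb)) divfK // expr2 (inj_eq (mulfI ea)).
    by rewrite eq_sym.
  rewrite (eq_bigl _ _ ga); apply: eq_bigr => b ba; rewrite /hs_kernel -gE.
  have eb := unity_enum_neq0 b.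
  have d : e a - e b != 0 by rewrite subr_eq0 eq_sym (inj_eq e_inj).
  have d' : e b - e a != 0 by rewrite subr_eq0 (inj_eq e_inj).
  by field; rewrite d eb expr2 -mulrBr mulf_neq0.
move/eqP; rewrite -addr_eq0 -mulr2n -mulr_natl mulf_eq0 (negbTE F2).
by move/eqP.
Qed.

(** Since [hs_kernel e a b * (e b - e a) = - (e a + e b)], the sums for [s] and [s + 1] are related
    through full power sums. These vanish for exponents strictly between 0 and [N]; the exponent 0
    gives the term [- N], and each step adds 2. *)
Lemma sum_hs_kernel a s : 2%:R != 0 :> F -> (0 < s < N)%N ->
  \sum_(b | b != a) hs_kernel a b * e b ^+ s = (2 * s%:R - N%:R) * e a ^+ s.
Proof.
move=> F2; pose T s := \sum_(b | b != a) hs_kernel a b * e b ^+ s.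
pose S s := \sum_b e b ^+ s.
have TS k : T k.+1 = e a * T k + 2 * e a ^+ k.+1 - e a * S k - S k.+1.
  rewrite /S (bigD1 a) //= [in X in _ - X](bigD1 a) //= mulrDr -exprS.
  set u := e a ^+ k.+1; transitivity (e a * T k - e a *
      (\sum_(i | i != a) e i ^+ k) - \sum_(i | i != a) e i ^+ k.+1); last by ring.
  rewrite /T !mulr_sumr -!sumrB; apply: eq_bigr => b ba.
  rewrite exprS /hs_kernel.
  have d : e a - e b != 0 by rewrite subr_eq0 eq_sym (inj_eq e_inj).
  by field.
have S0 : S 0 = N%:R by rewrite /S -[X in X%:R]card_ord -sumr_const; apply: eq_bigr.
case/andP=> s0 sN; rewrite -/(T s); elim: s s0 sN => // -[_ _ N1|s IH _ sN].
  rewrite TS S0 /S sum_unity_enum ?N1 // [T 0](_ : _ = 0) ?expr1; first by ring.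
  by rewrite -[RHS](sum_hs_kernel0 a F2); apply: eq_bigr => b _; rewrite mulr1.
rewrite TS IH ?(ltnW sN) // /S !sum_unity_enum ?sN ?(ltnW sN) //.
by rewrite [e a ^+ s.+2]exprS -[s.+2%:R]natr1; ring.
Qed.

End RootsOfUnity.

(** * The lattice sites as roots of unity, and discrete Fourier inversion *)

Section LatticeSites.
Variables (R : realType) (N : nat).
Local Notation C := R[i].

Definition cis (t : R) : C := (cos t +i* sin t)%C.

Lemma cisD s t : cis (s + t) = cis s * cis t.
Proof. by rewrite /cis cosD sinD; apply/eqP; rewrite eq_complex /= !eqxx addrC eqxx. Qed.

Lemma cisX t n : cis t ^+ n = cis (t * n%:R).
Proof.
elim: n => [|n IH]; first by rewrite mulr0 /cis cos0 sin0.
by rewrite exprSr IH -natr1 mulrDr mulr1 cisD.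
Qed.

Lemma cis_2pi : cis (2 * pi) = 1.
Proof. by rewrite /cis mulr_natl cos2pi sin2pi. Qed.

Lemma cis_neq1 (t : R) : 0 < t < pi -> cis (2 * t) != 1.
Proof.
move=> tpi; apply/eqP; rewrite /cis => -[].
rewrite mulr_natl cos_mulr2n => c1 _.
have := sin2cos2 t; have -> : cos t ^+ 2 = 1 by lra.
by move/eqP; rewrite subrr sqrf_eq0 (gt_eqF (sin_gt0_pi tpi)).
Qed.

Lemma root_site_unity (a : 'I_N) : root_site R a ^+ N = 1.
Proof.
have N0 : N%:R != 0 :> R by rewrite pnatr_eq0 -lt0n (leq_ltn_trans _ (ltn_ord a)).
rewrite [root_site R a](_ : _ = cis (2 * pi * a.+1%:R / N%:R)) // cisX.
by rewrite divfK // -cisX cis_2pi expr1n.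
Qed.

Lemma root_site_inj : injective (@root_site R N).
Proof.
move=> a b; wlog ab : a b / (a < b)%N => [H eab|].
  by have [/H->|/H->|/val_inj] := ltngtP a b.
pose x c : R := 2 * pi * c%:R / N%:R.
have eE (c : 'I_N) : root_site R c = cis (x c.+1) by [].
have N0 : (0 < N)%N by apply: leq_ltn_trans (ltn_ord a).
have -> : root_site R b = root_site R a * cis (2 * (pi * (b - a)%:R / N%:R)).
  rewrite !eE -cisD; congr cis; rewrite /x natrB 1?ltnW // -!natr1; field.
  by rewrite pnatr_eq0 -lt0n.
move/eqP; rewrite eq_sym -subr_eq0 -{2}[root_site R a]mulr1 -mulrBr mulf_eq0.
rewrite (negbTE (unity_enum_neq0 root_site_unity a)) subr_eq0 /=.
rewrite (negbTE (cis_neq1 _)) // divr_gt0 ?mulr_gt0 ?pi_gt0 ?ltr0n ?subn_gt0 //=.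
rewrite ltr_pdivrMr ?ltr0n // ltr_pM2l ?pi_gt0 // ltr_nat.
by rewrite (leq_ltn_trans (leq_subr _ _)).
Qed.

Lemma root_site_conj (a : 'I_N) : (root_site R a)^* = (root_site R a)^-1.
Proof.
have N0 : (0 < N)%N by apply: leq_ltn_trans (ltn_ord a).
have /eqP := congr1 Num.norm (root_site_unity a).
by rewrite normrX normr1 pexpr_eq1 // invC_norm => /eqP ->; rewrite expr1n invr1 mul1r.
Qed.

(** Fourier inversion on the [N]-th roots of unity. It identifies the sums over [gamma] and [delta]
    in [Psi1] and [Psi2] with coefficients of the polynomial whose roots are the blue positions. *)
Lemma coef_dft (p : {poly C}) n : (n < N)%N -> (size p <= N)%N ->
  N%:R^-1 * \sum_(a < N) (root_site R a)^* ^+ n * p.[root_site R a] = p`_n.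
Proof.
move=> nN pN; have N0 : N%:R != 0 :> C by rewrite pnatr_eq0 -lt0n; lia.
under eq_bigr => a _ do rewrite root_site_conj (horner_coef_wide _ pN) mulr_sumr.
rewrite exchange_big (bigD1 (Ordinal nN)) //= [X in _ * (_ + X)]big1 => [|k kn].
  rewrite addr0 (eq_bigr (fun=> p`_n)) => [|a _].
    by rewrite sumr_const card_ord -[p`_n *+ N]mulr_natl mulKf.
  by rewrite mulrCA -exprMn mulVf ?expr1n ?mulr1 // (unity_enum_neq0 root_site_unity).
(* The residue of [k - n] modulo [N], taken strictly between 0 and [N], so that [sum_unity_enum]
   applies. *)
pose d := if (n < k)%N then (k - n)%N else (k + N - n)%N.
have nk : (k : nat) != n by apply: contraNneq kn => h; apply/eqP/val_inj.
transitivity (\sum_(a < N) p`_k * root_site R a ^+ d).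
  apply: eq_bigr => a _; rewrite mulrCA; congr (_ * _).
  have e0 : root_site R a ^+ n != 0.
    by rewrite expf_neq0 // (unity_enum_neq0 root_site_unity).
  apply: (mulfI e0); rewrite mulrA exprVn divff // mul1r -exprD /d.
  case: ltnP => h; first by rewrite subnKC // ltnW.
  rewrite subnKC; last by have := ltn_ord k; lia.
  by rewrite exprD root_site_unity mulr1.
rewrite -mulr_sumr (sum_unity_enum root_site_unity root_site_inj) ?mulr0 //.
by rewrite /d; have := ltn_ord k; case: (ltnP n k); lia.
Qed.

End LatticeSites.

(** * Homogeneous polynomial functions of the particle positions *)

Section MonomialSpan.
Variables (F : fieldType) (I : finType).
Implicit Types (f g : (I -> F) -> F) (lo hi s : I -> nat) (d : nat).

(** Homogeneous polynomials are kept as functions, so that amplitudes can be used as they stand; the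
    pointwise equations in the constructors make the predicate stable under extensional equality. *)
Inductive hspan lo hi d : ((I -> F) -> F) -> Prop :=
| hspan_zero f : f =1 (fun=> 0) -> hspan lo hi d f
| hspan_monomial k s f :
    (forall i, lo i <= s i <= hi i)%N -> (\sum_i s i)%N = d ->
    f =1 (fun x => k * \prod_i x i ^+ s i) -> hspan lo hi d f
| hspan_add f g h :
    hspan lo hi d f -> hspan lo hi d g -> h =1 (fun x => f x + g x) ->
    hspan lo hi d h.

Lemma eq_hspan lo hi d f g : f =1 g -> hspan lo hi d f -> hspan lo hi d g.
Proof.
move=> fg hf; case: hf fg => {f} [f f0|k s f sb sd fE|f f1 f2 h1 h2 fE] fg.
- by apply: hspan_zero => x; rewrite -fg.
- by apply: hspan_monomial sb sd _ => x; rewrite -fg.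
- by apply: hspan_add h1 h2 _ => x; rewrite -fg.
Qed.

Lemma sub_hspan lo hi lo' hi' d f :
  (forall i, lo' i <= lo i)%N -> (forall i, hi i <= hi' i)%N ->
  hspan lo hi d f -> hspan lo' hi' d f.
Proof.
move=> l h; elim=> {f} [f|k s f sb sd|f g f' _ Hf _ Hg]; [exact: hspan_zero| |exact: hspan_add].
apply: hspan_monomial => [i|//]; have /andP[s1 s2] := sb i.
by rewrite (leq_trans (l i) s1) (leq_trans s2 (h i)).
Qed.

Lemma hspanM lo1 hi1 d1 f lo2 hi2 d2 g :
  hspan lo1 hi1 d1 f -> hspan lo2 hi2 d2 g ->
  hspan (fun i => lo1 i + lo2 i)%N (fun i => hi1 i + hi2 i)%N (d1 + d2)
    (fun x => f x * g x).
Proof.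
move=> hf hg; elim: hf => {f} [f f0|k s f sb sd fE|f f1 f2 _ h1 _ h2 fE].
- by apply: hspan_zero => x; rewrite f0 mul0r.
- elim: hg => {g} [g g0|k' s' g sb' sd' gE|g g1 g2 _ h1 _ h2 gE].
  + by apply: hspan_zero => x; rewrite g0 mulr0.
  + apply: (@hspan_monomial _ _ _ (k * k') (fun i => s i + s' i)%N) => [i||x].
    * have /andP[a b] := sb i; have /andP[a' b'] := sb' i.
      by rewrite !leq_add.
    * by rewrite big_split /= sd sd'.
    * rewrite fE gE mulrACA -big_split /=; congr (_ * _).
      by apply: eq_bigr => i _; rewrite exprD.
  + by apply: (hspan_add h1 h2) => x; rewrite gE mulrDr.
- by apply: (hspan_add h1 h2) => x; rewrite fE mulrDl.
Qed.

Lemma hspan_cst k : hspan (fun=> 0%N) (fun=> 0%N) 0 (fun=> k).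
Proof.
apply: (@hspan_monomial _ _ _ k (fun=> 0%N)) => //.
  by rewrite big1.
by move=> x; rewrite big1 ?mulr1 // => i _; rewrite expr0.
Qed.

Lemma hspanZ lo hi d k f : hspan lo hi d f -> hspan lo hi d (fun x => k * f x).
Proof. by move=> hf; have := hspanM (hspan_cst k) hf. Qed.

Lemma hspan_var a :
  hspan (fun i => i == a : nat) (fun i => i == a : nat) 1 (fun x => x a).
Proof.
apply: (@hspan_monomial _ _ _ 1 (fun i => i == a : nat)) => [i||x].
- by rewrite leqnn.
- by rewrite (bigD1 a) //= eqxx big1 // => i /negbTE ->.
rewrite (bigD1 a) //= eqxx big1 ?mulr1 ?mul1r // => i /negbTE -> //.
Qed.

Lemma hspan_diff a b :
  hspan (fun=> 0%N) (fun i => (i == a) + (i == b))%N 1 (fun x => x a - x b).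
Proof.
apply: (@hspan_add _ _ _ (fun x => x a) (fun x => -1 * x b)).
- by apply: sub_hspan (hspan_var a) => // i; rewrite leq_addr.
- by apply: hspanZ; apply: sub_hspan (hspan_var b) => // i; rewrite leq_addl.
by move=> x; rewrite mulN1r.
Qed.

Lemma hspan_prod (J : Type) (r : seq J) (P : pred J) (lo hi : J -> I -> nat)
    (d : J -> nat) (f : J -> (I -> F) -> F) :
  (forall j, P j -> hspan (lo j) (hi j) (d j) (f j)) ->
  hspan (fun i => \sum_(j <- r | P j) lo j i)%N
    (fun i => \sum_(j <- r | P j) hi j i)%N (\sum_(j <- r | P j) d j)%N
    (fun x => \prod_(j <- r | P j) f j x).
Proof.
move=> H; elim: r => [|j r IH].
  rewrite big_nil.
  by apply: eq_hspan (sub_hspan _ _ (hspan_cst 1)) => [x|i|i]; rewrite /= big_nil.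
rewrite big_cons; apply: (eq_hspan (f := fun x => (if P j then f j x else 1) *
    \prod_(k <- r | P k) f k x)) => [x|].
  by rewrite big_cons; case: ifP => // _; rewrite mul1r.
case Pj: (P j).
  by apply: sub_hspan (hspanM (H j Pj) IH) => i; rewrite /= big_cons Pj.
by apply: sub_hspan (hspanM (hspan_cst 1) IH) => i; rewrite /= big_cons Pj.
Qed.

Lemma hspan_sum (J : Type) (r : seq J) (P : pred J) lo hi d
    (f : J -> (I -> F) -> F) :
  (forall j, P j -> hspan lo hi d (f j)) ->
  hspan lo hi d (fun x => \sum_(j <- r | P j) f j x).
Proof.
move=> H; elim: r => [|j r IH]; first by apply: hspan_zero => x; rewrite big_nil.
apply: (@hspan_add _ _ _ (fun x => if P j then f j x else 0) _ _ _ IH) => [|x].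
  by case Pj: (P j); [exact: H|exact: hspan_zero].
by rewrite big_cons; case: ifP => // _; rewrite add0r.
Qed.

(** Up to sign this coefficient is the elementary symmetric polynomial of degree [d], which has
    degree at most one in each variable. *)
Lemma hspan_coef_prod_XsubC (r : seq I) n d : uniq r -> (n + d)%N = size r ->
  hspan (fun=> 0%N) (fun i => i \in r : nat) d
    (fun x => (\prod_(i <- r) ('X - (x i)%:P))`_n).
Proof.
elim: r n d => [|a r IH] n d /=.
  move=> _ /eqP; rewrite addn_eq0 => /andP[/eqP-> /eqP->].
  apply: eq_hspan (sub_hspan _ _ (hspan_cst 1)) => // x.
  by rewrite big_nil coef1.
case/andP=> ar ur nd.
have aP i : ((i \in r) <= (i \in a :: r))%N.
  by rewrite inE; case: (i \in r); rewrite ?orbT // leq0n.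
apply: (hspan_add
  (f := fun x => if n is n'.+1 then (\prod_(i <- r) ('X - (x i)%:P))`_n' else 0)
  (g := fun x => - 1 * (x a * (\prod_(i <- r) ('X - (x i)%:P))`_n))) => [||x].
- case: n nd => [|n] nd; first exact: hspan_zero.
  by apply: sub_hspan (IH n d ur _) => //; apply: succn_inj; rewrite -addSn.
- apply: hspanZ; case: d nd => [|d] nd.
    apply: hspan_zero => x; rewrite nth_default ?mulr0 // size_prod_XsubC.
    by rewrite -nd addn0.
  rewrite -add1n; have nd' : (n + d)%N = size r by apply: succn_inj; rewrite -addnS.
  apply: sub_hspan (hspanM (hspan_var a) (IH n d ur nd')) => // i.
  by rewrite inE; case: eqVneq => [->|//]; rewrite (negbTE ar).
rewrite big_cons mulrBl coefB coefCM coefXM mulN1r; congr (_ - _).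
by case: n nd.
Qed.

End MonomialSpan.

(** * The kernel acting on homogeneous functions *)

Section LatticeSum.
Variables (F : fieldType) (N : nat) (e : 'I_N -> F).
Hypotheses (e_unity : forall a, e a ^+ N = 1) (e_inj : injective e).
Hypothesis F2 : 2%:R != 0 :> F.

(** Moving the variable [a] of a monomial only replaces [e a ^+ s a] by [e b ^+ s a], so
    [sum_hs_kernel] yields the factor [2 s_a - N]. Exponents outside [A] vanish, hence those in [A]
    add up to [d]. *)
Lemma hs_kernel_hspan (A : {pred 'I_N}) lo hi d f :
  hspan lo hi d f ->
  (forall i, i \in A -> 0 < lo i)%N -> (forall i, hi i < N)%N ->
  (forall i, i \notin A -> hi i = 0%N) ->
  \sum_(a in A) \sum_(b | b != a)
     hs_kernel e a b * f (fun i => if i == a then e b else e i) =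
  (2 * d%:R - N%:R * #|A|%:R) * f e.
Proof.
move=> hf l1 hN h0; elim: hf => {f} [f f0|k s f sb sd fE|f f1 f2 _ h1 _ h2 fE].
- rewrite f0 mulr0 big1 // => a _; rewrite big1 // => b _.
  by rewrite f0 mulr0.
- have termE a : a \in A -> \sum_(b | b != a)
      hs_kernel e a b * f (fun i => if i == a then e b else e i) =
      (2 * (s a)%:R - N%:R) * f e.
    move=> aA; rewrite [in RHS]fE [in RHS](bigD1 a) //=.
    set P := \prod_(i | i != a) _; set t := 2 * _ - _.
    have -> : t * (k * (e a ^+ s a * P)) = t * e a ^+ s a * (k * P) by ring.
    rewrite -(@sum_hs_kernel _ _ _ e_unity e_inj) //; last first.
      have /andP[s1 s2] := sb a.
      by rewrite (leq_trans (l1 a aA) s1) (leq_ltn_trans s2 (hN a)).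
    rewrite mulr_suml; apply: eq_bigr => b _.
    rewrite fE (bigD1 a) //= eqxx (eq_bigr (fun i => e i ^+ s i)) => [|i /negbTE -> //].
    by rewrite -/P; ring.
  rewrite (eq_bigr _ termE) -mulr_suml; congr (_ * _).
  rewrite sumrB -mulr_sumr sumr_const -[N%:R *+ _]mulr_natr; congr (_ * _ - _).
  rewrite -natr_sum -sd [in RHS](bigID (mem A)) /= [X in (_ + X)%N]big1 ?addn0 //.
  by move=> i iA; have /andP[_] := sb i; rewrite (h0 i iA) leqn0 => /eqP.
- rewrite fE mulrDr -h1 -h2 -big_split; apply: eq_bigr => a _ /=.
  by rewrite -big_split; apply: eq_bigr => b _ /=; rewrite fE mulrDr.
Qed.

End LatticeSum.

(** * Amplitudes of color configurations *)

Section Amplitude.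
Variables (F : fieldType) (N : nat).
Implicit Types (c : config N) (x : 'I_N -> F) (H : {poly F} -> F).

Definition ncol (s : color) c : nat := #|[pred a | c a == s]|.

Definition col_prod (s t : color) c x : F :=
  \prod_(a | c a == s) \prod_(b | (c b == t) && (b != a)) (x a - x b).

Definition blue_poly c x : {poly F} := \prod_(a | c a == blue) ('X - (x a)%:P).

(* On a placement this is the wave function up to the sign [pair_sign M1 *
   pair_sign M2]: the squared differences become products over ordered pairs,
   and the factor multiplying [Psi0] is a function [H] of the polynomial whose
   roots are the blue positions. *)
Definition amp H c x : F :=
  col_prod blue blue c x * col_prod red red c x * col_prod blue red c x *
  (\prod_(a | c a == blue) x a) * (\prod_(a | c a == red) x a) *
  H (blue_poly c x).

Definition permute_config c (g : {perm 'I_N}) : config N := [ffun i => c (g i)].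

Lemma ncol_permute s c g : ncol s (permute_config c g) = ncol s c.
Proof.
rewrite /ncol -!sum1_card [RHS](reindex_inj (@perm_inj _ g)) /=.
by apply: eq_bigl => a; rewrite !inE ffunE.
Qed.

Lemma col_prod_permute s t c x (g : {perm 'I_N}) :
  col_prod s t (permute_config c g) (x \o g) = col_prod s t c x.
Proof.
rewrite [RHS](reindex_inj (@perm_inj _ g)) /col_prod.
apply: eq_big => [a|a _]; first by rewrite ffunE.
rewrite [RHS](reindex_inj (@perm_inj _ g)); apply: eq_big => [b|//].
by rewrite ffunE (inj_eq perm_inj).
Qed.

Lemma amp_permute H c x (g : {perm 'I_N}) :
  amp H (permute_config c g) (x \o g) = amp H c x.
Proof.
rewrite /amp !col_prod_permute /blue_poly.
have E s (f : 'I_N -> F) : \prod_(a | permute_config c g a == s) f (g a) =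
    \prod_(a | c a == s) f a.
  by rewrite [RHS](reindex_inj (@perm_inj _ g)); apply: eq_bigl => a; rewrite ffunE.
rewrite !E; congr (_ * H _).
by rewrite [RHS](reindex_inj (@perm_inj _ g)); apply: eq_bigl => a; rewrite ffunE.
Qed.

(** Together with [amp_permute], this expresses the hop of a particle from [a] to a green site [b]
    as a change of the single coordinate [x a]. *)
Lemma eq_amp H c x y : (forall a, c a != green -> x a = y a) -> amp H c x = amp H c y.
Proof.
move=> xy; have xyc s a : s != green -> c a == s -> x a = y a.
  by move=> sg /eqP ca; apply: xy; rewrite ca.
have E s t : s != green -> t != green -> col_prod s t c x = col_prod s t c y.
  move=> sg tg; apply: eq_bigr => a ca; apply: eq_bigr => b /andP[cb _].
  by rewrite (xyc s a) // (xyc t b).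
rewrite /amp !E // /blue_poly.
have E1 s : s != green -> \prod_(a | c a == s) x a = \prod_(a | c a == s) y a.
  by move=> sg; apply: eq_bigr => a ca; rewrite (xyc s a).
rewrite !E1 //; congr (_ * H _).
by apply: eq_bigr => a ca; rewrite (xyc blue a).
Qed.

Lemma col_prod_eq0 s t c x a b :
  c a = s -> c b = t -> a != b -> x a = x b -> col_prod s t c x = 0.
Proof.
move=> ca cb ab xab; rewrite /col_prod (bigD1 a) ?ca //=.
by rewrite (bigD1 b) /= ?xab ?subrr ?mul0r // cb eqxx eq_sym.
Qed.

(** Allows the target site of a hop to range over all sites other than [a]: on an occupied site the
    amplitude vanishes. *)
Lemma amp_collision H c x a b :
  c a != green -> c b != green -> a != b -> x a = x b -> amp H c x = 0.
Proof.
move=> ca cb ab xab; rewrite /amp.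
have ba : b != a by rewrite eq_sym.
have := @col_prod_eq0 blue blue c x a b.
have := @col_prod_eq0 red red c x a b.
have := @col_prod_eq0 blue red c x a b.
have := @col_prod_eq0 blue red c x b a.
move: ca cb; move: (c a) (c b).
apply: color_ind; apply: color_ind => // _ _ h1 h2 h3 h4.
- by rewrite h4 // !mul0r.
- by rewrite h2 // mulr0 !mul0r.
- by rewrite h1 // mulr0 !mul0r.
- by rewrite h3 // mulr0 !mul0r.
Qed.

Lemma card_colD1 s t c a : c a == s ->
  #|[pred b | (c b == t) && (b != a)]| = (ncol t c - (s == t))%N.
Proof.
move=> /eqP ca; rewrite /ncol (cardD1 a [pred b | c b == t]) inE ca addnC addnK.
by apply: eq_card => b; rewrite !inE andbC.
Qed.

(** Each difference is linear in its two variables; the two summands of the upper bound count the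
    occurrences of [x i] as first and as second entry of a pair. *)
Lemma hspan_col_prod s t c :
  hspan (fun=> 0%N)
    (fun i => (c i == s) * (ncol t c - (s == t)) +
              (c i == t) * (ncol s c - (t == s)))%N
    (ncol s c * (ncol t c - (s == t))) (col_prod s t c).
Proof.
have h := hspan_prod (index_enum _) (fun a (ca : c a == s) => hspan_prod (index_enum _)
  (fun b (cb : (c b == t) && (b != a)) => hspan_diff F a b)).
have dE : (\sum_(a | c a == s) \sum_(b | (c b == t) && (b != a)) 1)%N =
    (ncol s c * (ncol t c - (s == t)))%N.
  rewrite (eq_bigr (fun=> ncol t c - (s == t))%N) => [|a ca].
    by rewrite sum_nat_const.
  by rewrite sum1_card (card_colD1 t ca).
have sumI (P : pred 'I_N) i K : (\sum_(a | P a) (i == a) * K)%N = (P i * K)%N.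
  rewrite -big_distrl /= big_mkcond (bigD1 i) //= eqxx big1 ?addn0.
    by case: (P i).
  by move=> a; rewrite eq_sym => /negbTE ->; case: ifP.
rewrite -dE; apply: sub_hspan h => i; first by [].
under eq_bigr => a _ do rewrite big_split.
rewrite big_split /= leq_add //.
  rewrite -(sumI (fun j => c j == s)) leq_sum // => a ca.
  by rewrite sum_nat_const (card_colD1 t ca) mulnC.
rewrite (exchange_big_dep (fun b => c b == t)) /=; last by move=> a b _ /andP[].
rewrite -(sumI (fun j => c j == t)) leq_sum // => b cb.
rewrite sum_nat_const mulnC leq_mul2l; apply/orP; right.
rewrite -(card_colD1 s cb) subset_leq_card //; apply/subsetP => a.
by rewrite !inE unfold_in cb /= [b == a]eq_sym.
Qed.

Lemma hspan_col_vars s c :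
  hspan (fun i => c i == s : nat) (fun i => c i == s : nat) (ncol s c)
    (fun x => \prod_(a | c a == s) x a).
Proof.
have h := hspan_prod (index_enum _) (fun a (ca : c a == s) => hspan_var F a).
have sumI i : (\sum_(a | c a == s) (i == a))%N = (c i == s).
  rewrite big_mkcond (bigD1 i) //= eqxx big1 ?addn0; first by case: eqP.
  by move=> a; rewrite eq_sym => /negbTE ->; case: ifP.
rewrite /ncol -sum1_card.
by apply: sub_hspan h => i; rewrite sumI.
Qed.

Lemma hspan_blue_coef c n : (n <= ncol blue c)%N ->
  hspan (fun=> 0%N) (fun i => c i == blue : nat) (ncol blue c - n)
    (fun x => (blue_poly c x)`_n).
Proof.
move=> nb; have := @hspan_coef_prod_XsubC F _ (enum [pred a | c a == blue]) n
  (ncol blue c - n) (enum_uniq _).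
rewrite subnKC // -cardE => /(_ erefl) h.
apply: eq_hspan (sub_hspan _ _ h) => [x|i|i] //; last by rewrite mem_enum inE.
by rewrite big_enum.
Qed.

(** The degree in a red variable is at most [2 (M2 - 1) + M1 + 1 = N - 1], and in a blue one at most
    [2 (M1 - 1) + M2 + 1 + k], which is at most [N - 1] by the bound on [k]. The lower bound 1 comes
    from the products of the positions. *)
Lemma hspan_amp H c M1 M2 k dh :
  N = (M1 + 2 * M2)%N -> (M1 + k <= M2)%N -> ncol blue c = M1 -> ncol red c = M2 ->
  hspan (fun=> 0%N) (fun i => k * (c i == blue))%N dh (fun x => H (blue_poly c x)) ->
  hspan (fun i => c i != green : nat) (fun i => (c i != green) * N.-1)%N
    (M1 * M1 + M2 * M2 + M1 * M2 + dh) (amp H c).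
Proof.
move=> NE kM c1 c2 hH.
have := hspanM (hspanM (hspanM (hspanM (hspanM (hspan_col_prod blue blue c)
  (hspan_col_prod red red c)) (hspan_col_prod blue red c)) (hspan_col_vars blue c))
  (hspan_col_vars red c)) hH.
rewrite c1 c2 /= => h.
have -> : (M1 * M1 + M2 * M2 + M1 * M2 + dh =
  M1 * (M1 - 1) + M2 * (M2 - 1) + M1 * (M2 - 0) + M1 + M2 + dh)%N.
  by rewrite subn0 !mulnBr !muln1; have := leq_pmulr M1; have := leq_pmulr M2; nia.
apply: sub_hspan h => i /=.
  by move: (c i); apply: color_ind.
have b0 : c i == blue -> (0 < M1)%N.
  by move=> ci; rewrite -c1; apply/card_gt0P; exists i.
have r0 : c i == red -> (0 < M2)%N.
  by move=> ci; rewrite -c2; apply/card_gt0P; exists i.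
move: b0 r0; move: (c i).
by apply: color_ind => /= [/(_ isT) b0 _|_ /(_ isT) r0|_ _] //; lia.
Qed.

End Amplitude.

(** * Eigenvalues of the diagonal rapidity operators *)

Section Operators.
Variables (R : realType) (N : nat).
Local Notation C := R[i].
Local Notation e := (@root_site R N).
Implicit Types (c : config N) (v : hilbert R N) (H : {poly C} -> C).

Let C2 : 2%:R != 0 :> C. Proof. by rewrite pnatr_eq0. Qed.

(** On two sites colored [s] and [t] the two colorflips exchange the colors, which is the action of
    a transposition of sites. *)
Lemma pairingE s t v c :
  pairing R N s t v c = \sum_a \sum_(b | b != a) hs_kernel e a b *
    (if (c a == s) && (c b == t) then v (permute_config c (tperm a b)) else 0).
Proof.
rewrite /pairing sum_lfunE sum_ffunE; apply: eq_bigr => a _.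
rewrite sum_lfunE sum_ffunE; apply: eq_big => [b|b ab]; first by rewrite eq_sym.
rewrite scale_lfunE ffunE comp_lfunE !colorflipE /recolor !ffunE.
have -> : (b == a) = false by rewrite eq_sym (negbTE ab).
congr (_ * _); case: eqP => //= ca; case: eqP => //= cb.
congr (v _); apply/ffunP => i; rewrite !ffunE.
case: tpermP => [->|->|/eqP/negbTE -> /eqP/negbTE -> //].
  by rewrite eqxx (negbTE ab) cb.
by rewrite eqxx ca.
Qed.

Definition color_swap : {perm color} := tperm red green.

Definition swap_config c : config N := [ffun a => color_swap (c a)].

Lemma swap_configK : involutive swap_config.
Proof. by move=> c; apply/ffunP => a; rewrite !ffunE tpermK. Qed.

Lemma pairing_swap s t v k c :
  (forall c, v (swap_config c) = k * v c) ->
  pairing R N (color_swap s) (color_swap t) v (swap_config c) =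
    k * pairing R N s t v c.
Proof.
move=> vk; rewrite [LHS]pairingE [in RHS]pairingE mulr_sumr; apply: eq_bigr => a _.
rewrite mulr_sumr; apply: eq_bigr => b _; rewrite mulrCA; congr (_ * _).
rewrite !ffunE !(inj_eq perm_inj); case: ifP => _; last by rewrite mulr0.
by rewrite -vk; congr (v _); apply/ffunP => i; rewrite !ffunE.
Qed.

Lemma ncol_swap s c : ncol (color_swap s) (swap_config c) = ncol s c.
Proof. by apply: eq_card => a; rewrite !inE ffunE (inj_eq perm_inj). Qed.

Lemma ncol_sum c : (ncol blue c + ncol red c + ncol green c)%N = N.
Proof.
have E s : ncol s c = (\sum_a (c a == s))%N.
  by rewrite /ncol -sum1_card big_mkcond; apply: eq_bigr => a _; rewrite inE; case: eqP.
rewrite !E -!big_split -[RHS]card_ord -[RHS]sum1_card; apply: eq_bigr => a _.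
by move: (c a); apply: color_ind.
Qed.

Lemma col_prod_swap s t c (x : 'I_N -> C) :
  col_prod (color_swap s) (color_swap t) (swap_config c) x = col_prod s t c x.
Proof.
rewrite /col_prod; apply: eq_big => [a|a _]; first by rewrite ffunE (inj_eq perm_inj).
by apply: eq_bigl => b; rewrite ffunE (inj_eq perm_inj).
Qed.

Lemma col_prod_anti s t c (x : 'I_N -> C) : s != t ->
  col_prod s t c x = (-1) ^+ (ncol s c * ncol t c) * col_prod t s c x.
Proof.
have E (u w : color) : u != w -> col_prod u w c x =
    \prod_(a | c a == u) \prod_(b | c b == w) (x a - x b).
  move=> uw; apply: eq_bigr => a /eqP ca; apply: eq_bigl => b.
  by apply: andb_idr => /eqP cb; apply: contraNneq uw => ba; rewrite -ca -cb ba.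
move=> st; rewrite E // E 1?eq_sym // [LHS]exchange_big /=.
have -> : (-1) ^+ (ncol s c * ncol t c) =
    \prod_(b | c b == t) \prod_(a | c a == s) -1 :> C.
  by rewrite exprM !prodr_const.
rewrite -big_split; apply: eq_bigr => b _ /=; rewrite -big_split.
by apply: eq_bigr => a _ /=; rewrite mulN1r opprB.
Qed.

(** The product of [prod_unity_enum_diff] over all sites [a] of color [s], with the other sites [b]
    sorted by color. *)
Lemma col_prod_all s c : (\prod_(a | c a == s) e a) *
  (col_prod s blue c e * col_prod s red c e * col_prod s green c e) =
  N%:R ^+ ncol s c.
Proof.
rewrite /col_prod -!big_split /= -prodr_const.
apply: eq_bigr => a _.
rewrite -(prod_unity_enum_diff (@root_site_unity R N) (@root_site_inj R N) a).
congr (_ * _); have E t : \prod_(b | (c b == t) && (b != a)) (e a - e b) =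
    \prod_(b | b != a) (if c b == t then e a - e b else 1) by exact: big_mkcondl.
rewrite !E -!big_split; apply: eq_bigr => b _.
by move: (c b); apply: color_ind; rewrite /= ?mulr1 ?mul1r.
Qed.

Lemma col_prod_neq0 s t c : col_prod s t c e != 0.
Proof.
apply/prodf_neq0 => a _; apply/prodf_neq0 => b /andP[_ ba].
by rewrite subr_eq0 (inj_eq (@root_site_inj R N)) eq_sym.
Qed.

(** [col_prod_all] has the same value for red and for green. Equating the two and reversing the
    mixed products leaves the sign [(-1) ^+ (M * M)], which is [(-1) ^+ M]. *)
Lemma amp_swap H c M : ncol red c = M -> ncol green c = M ->
  amp H (swap_config c) e = (-1) ^+ M * amp H c e.
Proof.
move=> cr cg.
have bE : color_swap blue = blue by rewrite /color_swap tpermD.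
have gE : color_swap green = red by rewrite /color_swap tpermR.
have varE s : \prod_(a | swap_config c a == color_swap s) e a = \prod_(a | c a == s) e a.
  by apply: eq_bigl => a; rewrite ffunE (inj_eq perm_inj).
have bpE : blue_poly (swap_config c) e = blue_poly c e.
  by apply: eq_bigl => a; rewrite ffunE -{1}bE (inj_eq perm_inj).
rewrite /amp bpE [RHS]mulrA; congr (_ * _).
have := col_prod_swap blue blue c e; have := col_prod_swap green green c e.
have := col_prod_swap blue green c e; have := varE blue; have := varE green.
rewrite bE gE => -> -> -> -> ->.
have MM : (-1) ^+ (M * M) = (-1) ^+ M :> C by rewrite -signr_odd oddM andbb signr_odd.
(* The common factor of the two instances of [col_prod_all], cancelled at the end. *)
have : (-1) ^+ (M * ncol blue c) * col_prod red green c e != 0.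
  by rewrite mulf_neq0 ?signr_eq0 ?col_prod_neq0.
have := col_prod_all red c; rewrite cr -cg -(col_prod_all green c).
rewrite (@col_prod_anti red blue) // (@col_prod_anti green blue) //.
rewrite (@col_prod_anti green red) // cr cg MM.
move: (\prod_(a | c a == red) _) (\prod_(a | c a == green) _) => vr vg.
move: (\prod_(a | _) _) (_ ^+ (M * _)) => vb k.
move: (col_prod _ _ _ _) (col_prod _ _ _ _) (col_prod _ _ _ _) (col_prod _ _ _ _)
  (col_prod _ _ _ _) (col_prod _ _ _ _) => dbb dgg dbg drg drr dbr E nz.
have ss : (-1) ^+ M * (-1) ^+ M = 1 :> C by rewrite -exprMn mulrNN mulr1 expr1n.
move: ss E; move: ((-1) ^+ M : C) => sg ss E.
apply: (mulfI nz).
have -> : k * drg * (sg * (dbb * drr * dbr * vb * vr)) =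
    sg * dbb * vb * (vr * (k * dbr * drr * drg)) by ring.
rewrite E; transitivity (sg * sg * (k * drg * (dbb * dgg * dbg * vb * vg))); last by ring.
by rewrite ss mul1r.
Qed.

(** By [ketE] this is, up to a scalar, the ket of the wave function in product-basis coordinates. *)
Definition wstate H M1 M2 : hilbert R N :=
  [ffun c => if (ncol blue c == M1) && (ncol red c == M2) then amp H c e else 0].

Section Eigenstates.
Variables (H : {poly C} -> C) (M1 M2 k dh : nat).
Hypothesis NE : N = (M1 + 2 * M2)%N.
Hypothesis kM : (M1 + k <= M2)%N.
Hypothesis hH : forall c, ncol blue c = M1 ->
  hspan (fun=> 0%N) (fun i => k * (c i == blue))%N dh (fun x => H (blue_poly c x)).
Local Notation w := (wstate H M1 M2).

Let lambda : C := 2 * (M1 * M1 + M2 * M2 + M1 * M2 + dh)%:R - N%:R * (M1 + M2)%:R.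

(** At a configuration [c] the two pairings together sum over all hops of a blue or red particle to
    a green site. Extended to all target sites, this is the sum of [hs_kernel_hspan] with [A] the
    set of occupied sites. *)
Lemma pairing_green_wstate :
  pairing R N blue green w + pairing R N red green w = lambda *: w.
Proof.
apply/ffunP => c.
rewrite [LHS](_ : _ = pairing R N blue green w c + pairing R N red green w c); last first.
  by rewrite ffunE.
rewrite [RHS](_ : _ = lambda * w c); last by rewrite ffunE.
rewrite [LHS](congr2 +%R (pairingE blue green w c) (pairingE red green w c)).
rewrite -big_split /=.
(* Transpositions of sites preserve the color numbers, so both sides vanish where these are
   wrong. *)
have [/andP[/eqP c1 /eqP c2]|cN] := boolP ((ncol blue c == M1) && (ncol red c == M2));
    last first.
  rewrite [w c]ffunE (negbTE cN) [RHS]mulr0 big1 // => a _; rewrite -big_split big1 // => b _ /=.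
  by rewrite !ffunE !ncol_permute (negbTE cN) !if_same !mulr0 addr0.
have eu := @root_site_unity R N; have ei := @root_site_inj R N.
have wE : w c = amp H c e by rewrite ffunE c1 c2 !eqxx.
have := hs_kernel_hspan eu ei C2 (A := [pred a | c a != green])
  (hspan_amp NE kM c1 c2 (hH c1)).
have -> : #|[pred a | c a != green]| = (M1 + M2)%N.
  apply/eqP; rewrite -(eqn_add2r (ncol green c)) -c1 -c2 ncol_sum addnC.
  by rewrite -[X in _ == X]card_ord -(cardC [pred a | c a == green]).
rewrite -/lambda => main; rewrite [RHS](_ : _ = lambda * amp H c e) ?wE // -main.
- rewrite [RHS]big_mkcond; apply: eq_bigr => a _; rewrite inE -big_split /=.
  have [/eqP ca|ca] := boolP (c a == green).
    by rewrite big1 // => b _; rewrite ca /= !mulr0 addr0.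
  apply: eq_bigr => b ba; rewrite -mulrDr; congr (_ * _).
  (* If [b] is occupied, the pairings have no term and the amplitude has two coinciding
     positions. *)
  have [cb|cb] := boolP (c b == green); last first.
    have ab : a != b by rewrite eq_sym.
    by rewrite !andbF addr0 (amp_collision H ca cb ab) //= eqxx (negbTE ba).
  have -> : amp H c (fun i => if i == a then e b else e i) =
      w (permute_config c (tperm a b)).
    rewrite ffunE !ncol_permute c1 c2 !eqxx /=.
    rewrite -(amp_permute H c _ (tperm a b)); apply: eq_amp => i /=.
    by rewrite ffunE; case: tpermP => [->|->|/eqP/negbTE -> //]; rewrite ?cb ?eqxx.
  move: ca; rewrite !andbT; move: (c a); apply: color_ind => //= _.
    by rewrite addr0.
  by rewrite add0r.
- by move=> i ci; rewrite inE in ci; rewrite ci.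
- move=> i; have := ltn_ord i; case: (c i != green); rewrite ?mul0n ?mul1n; lia.
- by move=> i; rewrite inE negbK => ->.
Qed.

(** [N = M1 + 2 * M2] forces as many green as red sites, as [amp_swap] requires. *)
Lemma wstate_swap c : w (swap_config c) = (-1) ^+ M2 * w c.
Proof.
have nb := ncol_swap blue c; have nr := ncol_swap green c.
rewrite /color_swap tpermD // tpermR in nb nr.
rewrite !ffunE nb nr.
have E : (ncol blue c + ncol red c + ncol green c = M1 + 2 * M2)%N by rewrite ncol_sum.
case: eqP => c1 /=; last by rewrite mulr0.
have -> : (ncol green c == M2) = (ncol red c == M2) by apply/eqP/eqP; lia.
case: eqP => c2; last by rewrite mulr0.
by rewrite (@amp_swap _ _ M2) //; lia.
Qed.

(** Conjugation by the exchange of red and green turns the blue-green pairing into the blue-red one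
    and the red-green pairing into its opposite, so this is the image of [pairing_green_wstate]. *)
Lemma pairing_red_wstate :
  pairing R N blue red w - pairing R N red green w = lambda *: w.
Proof.
have -> : - pairing R N red green w = pairing R N green red w.
  by rewrite (pairingC R N red green) opp_lfunE.
apply/ffunP => c; rewrite -(swap_configK c); move: (swap_config c) => {}c.
have sw s t : pairing R N (color_swap s) (color_swap t) w (swap_config c) =
    (-1) ^+ M2 * pairing R N s t w c by exact: pairing_swap wstate_swap.
have := sw blue green; have := sw red green.
rewrite /color_swap tpermL tpermR tpermD // => h1 h2.
rewrite [LHS](_ : _ = pairing R N blue red w (swap_config c) +
  pairing R N green red w (swap_config c)); last by rewrite ffunE.
rewrite [RHS](_ : _ = lambda * w (swap_config c)); last by rewrite ffunE.
rewrite [LHS](congr2 +%R h2 h1) [RHS](congr1 ( *%R lambda) (wstate_swap c)).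
rewrite -mulrDr [RHS]mulrCA; congr (_ * _).
have := congr1 (fun v : hilbert R N => v c) pairing_green_wstate.
by rewrite /= ffunE => ->; rewrite ffunE.
Qed.

Lemma lfun_comb3 (k0 k1 k2 k3 : C) (A1 A2 A3 : 'End(hilbert R N)) v :
  (k0 *: (k1 *: A1 + k2 *: A2 + k3 *: A3))%R v =
  k0 *: (k1 *: A1 v + k2 *: A2 v + k3 *: A3 v).
Proof. by rewrite scale_lfunE !add_lfunE !scale_lfunE. Qed.

Lemma rapidity8_wstate : rapidity R N 8 w = (- (sqrtC 3 / 4) * lambda) *: w.
Proof.
pose d (s : color) : C := (sqrtC 3)^-1 * (if s == green then -2 else 1).
rewrite (@rapidity_diag_pairing _ _ _ d) => [|s t]; last first.
  move: s t; apply: color_ind; apply: color_ind; rewrite /d !mxE /=;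
  by rewrite ?(mulr0, mulr1, mul0r, mul1r, addr0, add0r, subr0, sub0r, mulrN, oppr0).
have q3 : sqrtC 3 = 3 * (sqrtC 3)^-1 :> C.
  apply: (canRL (mulfK _)); first by rewrite sqrtC_eq0 pnatr_eq0.
  by rewrite -expr2 sqrtCK.
rewrite /d /= subrr scale0r add0r -scalerDr scalerA scale_lfunE add_lfunE.
rewrite pairing_green_wstate scalerA; congr (_ *: _); rewrite [in RHS]q3.
by move: (sqrtC 3 : C)^-1 lambda => q l; field.
Qed.

(** With [x], [y], [z] the blue-red, blue-green and red-green pairings applied to the state, the
    operator gives a quarter of [- 2 x - y + z]. Since [x - z] and [y + z] both equal [lambda *: w],
    the [z] terms cancel and [- 3 lambda] remains. *)
Lemma rapidity3_wstate :
  rapidity R N 3 w = (sqrtC 3 * (- (sqrtC 3 / 4) * lambda)) *: w.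
Proof.
pose d (s : color) : C := if s == blue then 1 else if s == red then -1 else 0.
rewrite (@rapidity_diag_pairing _ _ _ d) => [|s t]; last first.
  move: s t; apply: color_ind; apply: color_ind; rewrite /d !mxE /=;
  by rewrite ?(subr0, sub0r, subrr, oppr0, mul0r, mul1r).
have s3 : sqrtC 3 * sqrtC 3 = 3 :> C by rewrite -expr2 sqrtCK.
have -> : sqrtC 3 * (- (sqrtC 3 / 4) * lambda) = - (3 / 4) * lambda.
  by rewrite -[in RHS]s3; move: (sqrtC 3 : C) lambda => q l; field.
rewrite lfun_comb3 /d /=.
(* Abstracting over the vectors keeps [rewrite] from unfolding the pairings. *)
have comb (x y z v : hilbert R N) l : x - z = l *: v -> y + z = l *: v ->
    4^-1 *: ((-1 - 1) *: x + (0 - 1) *: y + (0 - -1) *: z) = (- (3 / 4) * l) *: v.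
  move=> /eqP; rewrite subr_eq => /eqP -> /eqP; rewrite eq_sym -subr_eq => /eqP <-.
  by apply/ffunP => c; rewrite !ffunE /=; move: (z c) (v c) => zc vc;
    rewrite /GRing.scale /=; field.
exact: comb pairing_red_wstate pairing_green_wstate.
Qed.

End Eigenstates.

End Operators.

(** * Coordinates of kets *)

Section Increasing.
Variables (n N : nat).
Implicit Types f g : {ffun 'I_n -> 'I_N}.

Lemma enum_ord_ltn_sorted m : sorted (fun i j : 'I_m => (i < j)%N) (enum 'I_m).
Proof. by have := iota_ltn_sorted 0 m; rewrite -val_enum_ord sorted_map. Qed.

Lemma increasing_inj f : increasing f -> injective f.
Proof.
move=> /forallP incf i j fij; have := incf i => /forallP/(_ j).
have := incf j => /forallP/(_ i); rewrite fij ltnn !implybF -!leqNgt => ij ji.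
by apply/val_inj/eqP; rewrite eqn_leq ij ji.
Qed.

(** A strictly sorted list is determined by the set of its members. *)
Lemma increasing_codom_inj f g :
  increasing f -> increasing g -> codom f =i codom g -> f = g.
Proof.
move=> incf incg fg.
have srt (h : {ffun 'I_n -> 'I_N}) : increasing h -> sorted ltn (map val (codom h)).
  move=> /forallP inch; rewrite codomE -map_comp.
  apply: (@homo_sorted _ _ (val \o h) _ ltn _ _ (enum_ord_ltn_sorted n)) => i j ij.
  by have /forallP/(_ j)/implyP := inch i; apply.
have : map val (codom f) = map val (codom g).
  apply: (irr_sorted_eq ltn_trans ltnn); [exact: srt|exact: srt|].
  by apply: eq_mem_map.
move/(inj_map val_inj); rewrite !codomE => /eq_in_map h.
by apply/ffunP => i; apply: h; rewrite mem_enum.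
Qed.

Lemma increasing_exists (P : pred 'I_N) : #|P| = n ->
  exists2 f : {ffun 'I_n -> 'I_N}, increasing f & forall a, (a \in codom f) = P a.
Proof.
move=> Pn; have sz : size (enum P) == n by rewrite -cardE Pn.
pose t := Tuple sz; exists [ffun i => tnth t i].
  apply/forallP => i; apply/forallP => j; apply/implyP => ij; rewrite !ffunE.
  have [a0 _] : exists a0 : 'I_N, true by exists (tnth t i).
  rewrite !(tnth_nth a0).
  have tr : transitive (fun a b : 'I_N => (a < b)%N) by move=> b a c; apply: ltn_trans.
  apply: (sorted_ltn_nth tr) => //; rewrite ?inE ?size_tuple //.
  have := enum_ord_ltn_sorted N; rewrite enumT => srt.
  exact: sorted_filter tr _ _ srt.
move=> a; apply/codomP/idP => [[i ->]|Pa].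
  by rewrite ffunE; have := mem_tnth i t; rewrite mem_enum.
have /tnthP[i ai] : a \in t by rewrite mem_enum.
by exists i; rewrite ffunE.
Qed.

Lemma big_codom (T : Type) (idx : T) (op : Monoid.com_law idx) (P : pred 'I_N)
    (p : 'I_n -> 'I_N) (G : 'I_N -> T) :
  injective p -> (forall a, P a = (a \in codom p)) ->
  \big[op/idx]_(a | P a) G a = \big[op/idx]_i G (p i).
Proof.
move=> pinj Pp; rewrite -big_filter -(big_map p xpredT G); apply: perm_big.
apply: uniq_perm.
- by rewrite filter_uniq // index_enum_uniq.
- by rewrite map_inj_uniq // index_enum_uniq.
move=> a; rewrite mem_filter mem_index_enum andbT Pp.
apply/codomP/mapP => [[i ->]|[i _ ->]]; last by exists i.
by exists i; rewrite ?mem_index_enum.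
Qed.

End Increasing.

(** * Placements and product basis states *)

Section KetCoordinates.
Variables (R : realType) (N M1 M2 : nat).
Local Notation C := R[i].
Local Notation e := (@root_site R N).
Local Notation place := ({ffun 'I_M1 -> 'I_N} * {ffun 'I_M2 -> 'I_N})%type.
Implicit Types (c : config N) (p : place).

Lemma colorflip_seq_basis (r : seq 'I_N) s c :
  uniq r -> (forall a, a \in r -> c a = green) ->
  (\big[@comp_lfun _ _ _ _ / \1%VF]_(a <- r) colorflip R a s green) (basis_state R c) =
  basis_state R [ffun a => if a \in r then s else c a].
Proof.
elim: r => [|a r IH] /=.
  by move=> _ _; rewrite big_nil id_lfunE; congr basis_state; apply/ffunP => a; rewrite ffunE.
case/andP=> ar ur cg; rewrite big_cons comp_lfunE IH // => [|b br]; last first.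
  by apply: cg; rewrite inE br orbT.
rewrite colorflip_basis ffunE (negbTE ar) cg ?mem_head // eqxx.
congr basis_state; apply/ffunP => b; rewrite !ffunE inE.
by case: eqP.
Qed.

Definition place_config p : config N :=
  [ffun a => if a \in codom p.1 then blue else if a \in codom p.2 then red else green].

Lemma placementP p : placement p ->
  [/\ increasing p.1, increasing p.2 & forall a, a \in codom p.1 -> a \notin codom p.2].
Proof.
case/and3P=> inc1 inc2 /forallP dis; split=> // a /codomP[i ->].
by apply/negP => /codomP[k] /eqP; have /forallP/(_ k)/negbTE -> := dis i.
Qed.

Lemma place_blue p a : (place_config p a == blue) = (a \in codom p.1).
Proof. by rewrite ffunE; case: (a \in codom p.1) => //; case: ifP. Qed.

Lemma place_red p a : placement p -> (place_config p a == red) = (a \in codom p.2).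
Proof.
case/placementP=> _ _ dis; rewrite ffunE.
by have [/dis/negbTE ->|_] := boolP (a \in codom p.1); last by case: (a \in codom p.2).
Qed.

Lemma colorflips_vacuum p : placement p ->
  ((\big[@comp_lfun _ _ _ _ / \1%VF]_(i < M1) colorflip R (p.1 i) blue green) \o
   (\big[@comp_lfun _ _ _ _ / \1%VF]_(k < M2) colorflip R (p.2 k) red green))%VF
    (vacuum R N) = basis_state R (place_config p).
Proof.
move=> pl; have [inc1 inc2 dis] := placementP pl.
have i1 := increasing_inj inc1; have i2 := increasing_inj inc2.
rewrite -(big_map p.1 xpredT (fun a => colorflip R a blue green)).
rewrite -(big_map p.2 xpredT (fun a => colorflip R a red green)).
have memE m (f : {ffun 'I_m -> 'I_N}) a :
    (a \in map f (index_enum 'I_m)) = (a \in codom f).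
  by apply/mapP/codomP => [[i _ ->]|[i ->]]; exists i; rewrite ?mem_index_enum.
rewrite comp_lfunE /vacuum !colorflip_seq_basis ?map_inj_uniq ?index_enum_uniq //.
- congr basis_state; apply/ffunP => a; rewrite !ffunE !memE //.
- by move=> a; rewrite memE => /dis a2; rewrite !ffunE memE (negbTE a2).
- by move=> a _; rewrite ffunE.
Qed.

Lemma ncol_place p : placement p ->
  ncol blue (place_config p) = M1 /\ ncol red (place_config p) = M2.
Proof.
move=> pl; have [inc1 inc2 dis] := placementP pl; split.
  rewrite -[RHS]card_ord -(card_codom (increasing_inj inc1)).
  by apply: eq_card => a; rewrite !inE place_blue.
rewrite -[RHS]card_ord -(card_codom (increasing_inj inc2)).
by apply: eq_card => a; rewrite !inE place_red.
Qed.

(** With [place_config_inj] and [ncol_place], placements correspond bijectively to configurations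
    with the prescribed color numbers, so each coordinate of a ket is a single amplitude or zero. *)
Lemma place_exists c : ncol blue c = M1 -> ncol red c = M2 ->
  exists2 p, placement p & place_config p = c.
Proof.
move=> /increasing_exists [f incf fP] /increasing_exists [g incg gP].
exists (f, g).
  apply/and3P; split=> //; apply/forallP => i; apply/forallP => k.
  apply/negP => /= /eqP fg; have := codom_f f i; have := codom_f g k.
  by rewrite fP gP /= fg => /eqP ->.
apply/ffunP => a; rewrite ffunE /= fP gP /=.
by move: (c a); apply: color_ind.
Qed.

Lemma place_config_inj p q : placement p -> placement q ->
  place_config p = place_config q -> p = q.
Proof.
move=> pp pq pqE; have [p1 p2 _] := placementP pp; have [q1 q2 _] := placementP pq.
case: p q p1 p2 q1 q2 pp pq pqE => f g [f' g'] /= p1 p2 q1 q2 pp pq pqE.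
congr (_, _); apply: increasing_codom_inj => // a.
  by rewrite -(place_blue (f, g)) pqE place_blue.
by rewrite -(place_red _ pp) pqE place_red.
Qed.

Lemma ketE (Psi : wavefun R M1 M2) (H : {poly C} -> C) k :
  (forall p, placement p ->
     Psi (fun i => e (p.1 i)) (fun i => e (p.2 i)) = k * amp H (place_config p) e) ->
  ket N Psi = k *: wstate N H M1 M2.
Proof.
move=> PsiE; apply/ffunP => c; rewrite /ket sum_ffunE.
rewrite (eq_bigr (fun p => (c == place_config p)%:R * (k * amp H c e))) => [|p pl].
  rewrite !ffunE; have [/andP[/eqP c1 /eqP c2]|cN] := boolP (_ && _).
    have [p0 pl0 p0c] := place_exists c1 c2.
    rewrite (bigD1 p0) //= p0c eqxx mul1r big1 ?addr0 // => p /andP[pl pp0].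
    rewrite (_ : c == _ = false) ?mul0r //; apply: contra_neqF pp0 => /eqP cp.
    by apply: place_config_inj => //; rewrite p0c.
  rewrite big1 => [|p pl]; first by rewrite [RHS]mulr0.
  rewrite (_ : c == _ = false) ?mul0r //; apply: contraNF cN => /eqP ->.
  by have [-> ->] := ncol_place pl; rewrite !eqxx.
rewrite colorflips_vacuum // !ffunE PsiE //.
by case: eqP => [->|_]; rewrite ?mul1r ?mul0r; [exact: mulr1|exact: mulr0].
Qed.

End KetCoordinates.

(** * Nonvanishing *)

Section Nonvanishing.
Variables (F : fieldType) (N : nat) (e : 'I_N -> F).
Hypothesis e_inj : injective e.
Implicit Types s : seq 'I_N.

Definition seq_poly s : {poly F} := \prod_(a <- s) ('X - (e a)%:P).

Lemma seq_poly_cons_coef a s n :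
  (seq_poly (a :: s))`_n = ('X * seq_poly s)`_n - e a * (seq_poly s)`_n.
Proof. by rewrite /seq_poly big_cons mulrBl coefB coefCM. Qed.

Lemma exists_uniq_seq (P : pred 'I_N) n : (n <= #|P|)%N ->
  exists s, [/\ uniq s, size s = n & {subset s <= P}].
Proof.
move=> nP; exists (take n (enum P)); split.
- by rewrite take_uniq // enum_uniq.
- by rewrite size_takel // -cardE.
- by move=> a /mem_take; rewrite mem_enum.
Qed.

(** At least [size q] sites lie outside [s], more than [q] has roots. *)
Lemma exists_nonroot s (q : {poly F}) : uniq s -> q != 0 ->
  (size s + size q <= N)%N -> exists2 a, a \notin s & q.[e a] != 0.
Proof.
move=> us q0 sN.
have [|t [ut tz ts]] := @exists_uniq_seq [predC s] (size q).
  have := cardC [in s]; rewrite card_ord -(card_uniqP us) in sN *.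
  move=> h; rewrite -(leq_add2l #|s|); apply: leq_trans sN _.
  by rewrite -{1}h leq_add2l.
have : ~~ all (root q) (map e t).
  apply/negP => rt; have := max_poly_roots q0 rt; rewrite map_inj_uniq // size_map.
  by rewrite tz ltnn => /(_ ut).
rewrite all_map => /allPn [a ta qa]; exists a; last exact: qa.
exact: ts.
Qed.

(** Induction on the length [k]. For [n = k] the coefficient is the leading one; otherwise, adding a
    root [x] makes it a polynomial in [x] of degree one, whose slope is nonzero by induction. *)
Lemma exists_coef_neq0 k n : (n <= k)%N -> (k < N)%N ->
  exists s, [/\ uniq s, size s = k & (seq_poly s)`_n != 0].
Proof.
elim: k => [|k IH] nk kN.
  exists [::]; rewrite /seq_poly big_nil; split=> //.
  by move: nk; rewrite leqn0 => /eqP ->; rewrite coef1 oner_neq0.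
move: nk; rewrite leq_eqVlt => /orP[/eqP->|]; last rewrite ltnS => nk.
  have [|s [us sz _]] := @exists_uniq_seq predT k.+1; first by rewrite card_ord ltnW.
  exists s; split=> //; have : lead_coef (seq_poly s) = 1.
    by apply/monicP; apply: monic_prod_XsubC.
  by rewrite lead_coefE size_prod_XsubC sz => ->; rewrite oner_neq0.
have [s [us sz sn]] := IH nk (ltnW kN).
pose q := Poly [:: ('X * seq_poly s)`_n; - (seq_poly s)`_n].
have q0 : q != 0.
  by apply: contra_neq sn => q0; apply/oppr_inj; have := coef_Poly
    [:: ('X * seq_poly s)`_n; - (seq_poly s)`_n] 1; rewrite -/q q0 coef0 /= oppr0.
have [|a as_ qa] := exists_nonroot us q0.
  by rewrite sz (leq_trans _ kN) // -addn2 leq_add2l size_Poly.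
exists (a :: s); split; rewrite /= ?as_ ?sz //.
move: qa; rewrite horner_Poly seq_poly_cons_coef /= mul0r add0r.
by rewrite addrC mulNr [_ * e a]mulrC.
Qed.

(* Adding a root x turns the sum into a quadratic polynomial in x whose leading
   coefficient is the same sum for the shorter list; at length m only the term
   l = 0 is left. *)
Lemma exists_coef2_neq0 k m n L (a : nat -> F) :
  (n <= m)%N -> (m <= k)%N -> (k.+1 < N)%N -> (0 < L)%N -> a 0%N != 0 ->
  exists s, [/\ uniq s, size s = k &
    \sum_(0 <= l < L) a l * ((seq_poly s)`_(m + l) * (seq_poly s)`_(n - l)) != 0].
Proof.
move=> nm mk kN L0 a0; rewrite -(subnKC mk) in kN *; elim: (k - m)%N kN => [|i IH] kN.
  rewrite addn0 in kN *; have [s [us sz sn]] := exists_coef_neq0 nm (ltnW kN).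
  exists s; split=> //; case: L L0 => // L _; rewrite big_nat_recl // big1 ?addr0.
    rewrite addn0 subn0; have := monic_prod_XsubC s xpredT e.
    move/monicP; rewrite lead_coefE size_prod_XsubC sz => ->.
    by rewrite mul1r mulf_neq0.
  move=> l _; rewrite [_`_(m + _)]nth_default ?mul0r ?mulr0 //.
  by rewrite size_prod_XsubC sz addnS ltnS leq_addr.
have [|s [us sz sn]] := IH; first by rewrite addnS in kN; exact: ltnW.
pose p := seq_poly s; pose S (f g : nat -> F) := \sum_(0 <= l < L) a l * (f l * g l).
pose u l := ('X * p)`_(m + l); pose u' l := ('X * p)`_(n - l).
pose v l := p`_(m + l); pose v' l := p`_(n - l).
pose cs := [:: S u u'; - (S u v' + S v u'); S v v'].
have q0 : Poly cs != 0.
  by apply: contra_neq sn => q0; have := coef_Poly cs 2; rewrite q0 coef0.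
have [|b bs qb] := exists_nonroot us q0.
  rewrite sz (leq_trans _ kN) // addnS -[in leqRHS]addn3 leq_add2l.
  by rewrite -[3%N]/(size cs) size_Poly.
exists (b :: s); split; rewrite /= ?bs ?sz ?addnS //.
apply: contra_neq qb => Q0; rewrite horner_Poly /= mul0r add0r -[RHS]Q0.
rewrite mulrDl mulNr mulrDl -!mulrA /S !mulr_suml -big_split -sumrN -!big_split /=.
apply: eq_bigr => l _; rewrite !seq_poly_cons_coef -/p /u /u' /v /v'; ring.
Qed.

End Nonvanishing.

(** * The wave functions *)

Section WaveFunctions.
Variables (R : realType) (N M1 M2 : nat).
Local Notation C := R[i].
Local Notation e := (@root_site R N).
Local Notation place := ({ffun 'I_M1 -> 'I_N} * {ffun 'I_M2 -> 'I_N})%type.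
Implicit Types (c : config N) (p : place) (H : {poly C} -> C).

(** The sign [(-1)^(n(n-1)/2)], one factor for each unordered pair. *)
Definition pair_sign (n : nat) : C := \prod_(i < n) \prod_(j < n | (i < j)%N) -1.

Lemma pair_sign_sqr n : pair_sign n * pair_sign n = 1.
Proof.
rewrite -big_split big1 // => i _ /=; rewrite -big_split big1 // => j _ /=.
by rewrite mulrNN mulr1.
Qed.

Lemma col_prod_codom n (z : 'I_n -> 'I_N) s c (x : 'I_N -> C) : injective z ->
  (forall a, (c a == s) = (a \in codom z)) ->
  col_prod s s c x =
  pair_sign n * \prod_(i < n) \prod_(j < n | (i < j)%N) (x (z i) - x (z j)) ^+ 2.
Proof.
move=> zi cz; rewrite /col_prod (big_codom _ _ zi cz).
transitivity (\prod_i \prod_(j | j != i) (x (z i) - x (z j))).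
  apply: eq_bigr => i _; rewrite big_mkcondr (big_codom _ _ zi cz) /=.
  by rewrite [RHS]big_mkcond; apply: eq_bigr => j _; rewrite (inj_eq zi).
transitivity (\prod_(i < n) \prod_(j < n | (i < j)%N) (x (z i) - x (z j)) *
              \prod_(i < n) \prod_(j < n | (j < i)%N) (x (z i) - x (z j))).
  rewrite -big_split; apply: eq_bigr => i _ /=.
  rewrite (bigID (fun j : 'I_n => (i < j)%N)) /=; congr (_ * _); apply: eq_bigl => j.
    by rewrite -val_eqE /= neq_ltn; case: (ltngtP i j).
  by rewrite -val_eqE /= neq_ltn; case: (ltngtP i j).
rewrite [X in _ * X](exchange_big_dep predT) //= /pair_sign -!big_split /=.
apply: eq_bigr => i _; rewrite -!big_split; apply: eq_bigr => j _ /=.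
by rewrite expr2; ring.
Qed.

Lemma Psi0_amp H p (h : C) : placement p -> h = H (blue_poly (place_config p) e) ->
  h * Psi0 (fun i => e (p.1 i)) (fun k => e (p.2 k)) =
  pair_sign M1 * pair_sign M2 * amp H (place_config p) e.
Proof.
move=> pl ->; have [inc1 inc2 dis] := placementP pl.
have i1 := increasing_inj inc1; have i2 := increasing_inj inc2.
have c1 a := place_blue p a; have c2 a := @place_red N M1 M2 p a pl.
rewrite /amp (col_prod_codom e i1 c1) (col_prod_codom e i2 c2).
rewrite (big_codom _ _ i1 c1) (big_codom _ _ i2 c2).
have -> : col_prod blue red (place_config p) e = \prod_i \prod_k (e (p.1 i) - e (p.2 k)).
  rewrite /col_prod (big_codom _ _ i1 c1); apply: eq_bigr => i _.
  apply: big_codom i2 _ => a; rewrite c2; apply: andb_idr => a2.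
  by apply: contraTneq a2 => ->; rewrite dis ?codom_f.
rewrite /Psi0; have := pair_sign_sqr M1; have := pair_sign_sqr M2.
move: (pair_sign M1) (pair_sign M2) => s1 s2 s22 s11.
set hh := H _; set v1 := \prod_i \prod_k (e _ - e _).
set v2 := \prod_i e (p.1 i); set v3 := \prod_i e (p.2 i).
set u1 := \prod_(i < M1) _; set u2 := \prod_(i < M2) _.
transitivity ((s1 * s1) * (s2 * s2) * (hh * (u1 * u2 * v1 * v2 * v3))); last by ring.
by rewrite s11 s22 !mul1r.
Qed.

Lemma blue_poly_place p (x : C) : placement p ->
  (blue_poly (place_config p) e).[x] = \prod_i (x - e (p.1 i)).
Proof.
move=> pl; have [inc1 _ _] := placementP pl.
rewrite /blue_poly (big_codom _ _ (increasing_inj inc1) (place_blue p)) horner_prod.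
by apply: eq_bigr => i _; rewrite hornerXsubC.
Qed.

Lemma size_blue_poly c : size (blue_poly c e) = (ncol blue c).+1.
Proof.
rewrite /blue_poly -big_filter size_prod_XsubC; congr _.+1.
by rewrite /ncol cardE /enum_mem; congr size; apply: eq_filter => a; rewrite inE.
Qed.

(** Color [s] blue and [M2] further sites red: at this configuration every factor of [amp] is
    nonzero, since sites are distinct and nonzero and [H] is nonzero by assumption. *)
Lemma wstate_neq0 H (s : seq 'I_N) : (M1 + M2 <= N)%N ->
  uniq s -> size s = M1 -> H (seq_poly e s) != 0 -> wstate N H M1 M2 != 0.
Proof.
move=> MN us sz Hs; have scard : #|s| = M1 by rewrite (card_uniqP us).
have [|t [ut tz ts]] := @exists_uniq_seq N [predC s] M2.
  by rewrite -(leq_add2l #|s|) cardC card_ord scard.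
pose c : config N := [ffun a => if a \in s then blue else if a \in t then red else green].
have cb a : (c a == blue) = (a \in s) by rewrite ffunE; case: ifP => //; case: ifP.
have cr a : (c a == red) = (a \in t).
  rewrite ffunE; case: (boolP (a \in s)) => [as_|_]; last by case: ifP.
  by apply/esym/negbTE; apply: contraL as_ => /ts.
apply/eqP => /ffunP/(_ c) /eqP; rewrite !ffunE.
have -> : ncol blue c = M1 by rewrite -scard; apply: eq_card => a; rewrite !inE cb.
have -> : ncol red c = M2.
  by rewrite -tz -(card_uniqP ut); apply: eq_card => a; rewrite !inE cr.
rewrite !eqxx /=; apply/negP; rewrite /amp.
have pz u : \prod_(a | c a == u) e a != 0.
  by apply/prodf_neq0 => a _; apply: unity_enum_neq0 (@root_site_unity R N) a.
rewrite !mulf_neq0 ?col_prod_neq0 ?pz //.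
rewrite [blue_poly c e](_ : _ = seq_poly e s) // /blue_poly /seq_poly.
by rewrite (eq_bigl _ _ cb) big_uniq.
Qed.

(** The common form of the three cases, which differ only in [H]; [k] bounds the degree of [H] in
    each blue position and [d] is its total degree. *)
Lemma ket_eigenstate (Psi : wavefun R M1 M2) H k d (ev : C) :
  N = (M1 + 2 * M2)%N -> (M1 + k <= M2)%N ->
  (forall c, ncol blue c = M1 -> hspan (fun=> 0%N)
     (fun i => k * (c i == blue))%N d (fun x => H (blue_poly c x))) ->
  (forall p, placement p -> exists2 h, h = H (blue_poly (place_config p) e) &
     Psi (fun i => e (p.1 i)) (fun i => e (p.2 i)) =
     h * Psi0 (fun i => e (p.1 i)) (fun i => e (p.2 i))) ->
  (exists s, [/\ uniq s, size s = M1 & H (seq_poly e s) != 0]) ->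
  ev = - (sqrtC 3 / 4) *
    (2 * (M1 * M1 + M2 * M2 + M1 * M2 + d)%:R - N%:R * (M1 + M2)%:R) ->
  rapidity R N 8 (ket N Psi) = ev *: ket N Psi /\
  eigenstate (rapidity R N 3) (sqrtC 3 * ev) (ket N Psi).
Proof.
move=> NE kM hH PsiE [s [us sz Hs]] ->.
have ketw : ket N Psi = (pair_sign M1 * pair_sign M2) *: wstate N H M1 M2.
  apply: ketE => p pl; have [h hE ->] := PsiE p pl; exact: Psi0_amp.
have sg0 n : pair_sign n != 0.
  have /eqP := pair_sign_sqr n; apply: contraTneq => ->.
  by rewrite mulr0 eq_sym oner_eq0.
have w0 : wstate N H M1 M2 != 0 by apply: wstate_neq0 us sz Hs; lia.
rewrite ketw; split.
  rewrite linearZ /= (rapidity8_wstate NE kM hH) !scalerA; congr (_ *: _); exact: mulrC.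
split; first by rewrite scaler_eq0 negb_or w0 mulf_neq0.
rewrite linearZ /= (rapidity3_wstate NE kM hH) !scalerA; congr (_ *: _); exact: mulrC.
Qed.

End WaveFunctions.

(** * The choice of [H] and the degree count in the three cases *)

Theorem mainTheorem3 (R : realType) :
  (forall N M M1 M2 : nat,
     (1 <= M)%N -> N = (3 * M)%N -> M1 = M -> M2 = M ->
     let v := ket N (@Psi0 R M1 M2) in
     let ev : R[i] := 0 in
     rapidity R N 8 v = 0 /\
     eigenstate (rapidity R N 3) (sqrtC 3 * ev) v)
  /\
  (forall N M M1 M2 n : nat,
     (1 <= M)%N -> N = (3 * M - 1)%N ->
     M1 = ((N - 2) %/ 3)%N -> M2 = ((N + 1) %/ 3)%N ->
     (n <= M1)%N ->
     let v := ket N (@Psi1 R N M1 M2 n) in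
     let ev : R[i] := - (sqrtC 3 / 4) * ((N%:R - 2) / 3 - 2 * n%:R) in
     rapidity R N 8 v = ev *: v /\
     eigenstate (rapidity R N 3) (sqrtC 3 * ev) v)
  /\
  (forall N M M1 M2 m n : nat,
     (2 <= M)%N -> N = (3 * M - 2)%N ->
     M1 = ((N - 4) %/ 3)%N -> M2 = ((N + 2) %/ 3)%N ->
     (n <= m)%N -> (m <= M1)%N ->
     let v := ket N (@Phi R N M1 M2 m n) in
     let ev : R[i] :=
       - (sqrtC 3 / 4) * ((2 * N%:R - 8) / 3 - 2 * m%:R - 2 * n%:R) in
     rapidity R N 8 v = ev *: v /\
     eigenstate (rapidity R N 3) (sqrtC 3 * ev) v).
Proof.
split; last split.
- move=> N M M1 M2 M0 NE -> -> /=.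
  rewrite -[X in _ = X /\ _](scale0r (ket N (@Psi0 R M M))).
  apply: (@ket_eigenstate _ _ _ _ _ (fun=> 1) 0%N 0%N).
  + by rewrite NE; lia.
  + by rewrite addn0.
  + by move=> c _; exact: hspan_cst.
  + by move=> p pl; exists 1; rewrite ?mul1r.
  + have [|s [us sz _]] := @exists_uniq_seq N predT M; first by rewrite card_ord NE; lia.
    by exists s; split=> //; exact: oner_neq0.
  (* The total degree is [3 M^2], and [2 (3 M^2) - (3 M) (2 M) = 0]. *)
  + by rewrite NE addn0 !natrD !natrM; move: (sqrtC 3 : R[i]) => q; field.
- move=> N M M1 M2 n M0 NE M1E M2E nM /=.
  (* The surplus of one red particle leaves room for one extra degree in each blue position, hence
     [k = 1]. *)
  have {}M2E : M2 = M1.+1 by lia.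
  have {M M0 M1E}NE : N = (3 * M1 + 2)%N by lia.
  apply: (@ket_eigenstate _ _ _ _ _ (fun p => p`_n) 1%N (M1 - n)%N).
  + by lia.
  + by lia.
  + move=> c c1; have := @hspan_blue_coef R[i] N c n; rewrite c1 => /(_ nM).
    by apply: sub_hspan => i //; rewrite mul1n.
  + move=> p pl; have [c1 _] := ncol_place pl.
    eexists; last by rewrite /Psi1.
    rewrite -(@coef_dft R N) ?size_blue_poly ?c1; [|lia|lia].
    congr (_ * _); apply: eq_bigr => g _; by rewrite blue_poly_place.
  + by apply: exists_coef_neq0; [exact: root_site_inj|lia|lia].
  + congr (_ * _); rewrite M2E NE !natrD !natrM (natrB _ nM) -[M1.+1%:R]natr1.
    by field.
- move=> N M M1 M2 m n M0 NE M1E M2E nm mM /=.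
  have {}M2E : M2 = M1.+2 by lia.
  have {M M0 M1E}NE : N = (3 * M1 + 4)%N by lia.
  pose L := (minn (M1 - m) n).+1.
  (* Here [M2 = M1 + 2] permits [k = 2], one for each coefficient factor. Their degrees [M1 - m - l]
     and [M1 - n + l] have a sum independent of [l], so the combination is homogeneous. *)
  apply: (@ket_eigenstate _ _ _ _ _ (fun p => \sum_(l < L)
    acoef R m n l * (p`_(m + l) * p`_(n - l))) 2%N (M1 - m + (M1 - n))%N).
  + by lia.
  + by lia.
  + move=> c c1; apply: hspan_sum => l _; have := ltn_ord l; rewrite ltnS leq_min.
    case/andP=> lm ln.
    have := @hspan_blue_coef R[i] N c (m + l); have := @hspan_blue_coef R[i] N c (n - l).
    rewrite c1 => h1 h2; apply: hspanZ.
    rewrite [d in hspan _ _ d](_ : _ = M1 - (m + l) + (M1 - (n - l)))%N; last by lia.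
    apply: sub_hspan (hspanM (h2 _) (h1 _)) => [//|i||]; [|lia|lia].
    by rewrite mul2n addnn.
  + move=> p pl; have [c1 _] := ncol_place pl; eexists; first by [].
    rewrite /Phi -/L big_mkord mulr_suml; apply: eq_bigr => l _.
    have := ltn_ord l; rewrite ltnS leq_min => /andP[lm ln].
    rewrite -[RHS]mulrA; congr (_ * _); rewrite /Psi2; congr (_ * _).
    rewrite -(@coef_dft R N) ?size_blue_poly ?c1; [|lia|lia].
    rewrite -(@coef_dft R N (blue_poly _ _) (n - l)) ?size_blue_poly ?c1; [|lia|lia].
    (* The double sum over [gamma] and [delta] factors into two Fourier sums. *)
    rewrite mulrACA -invfM -expr2; congr (_ * _); rewrite mulr_suml.
    apply: eq_bigr => g _; rewrite mulr_sumr; apply: eq_bigr => g' _.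
    by rewrite !blue_poly_place // big_split /= mulrACA.
  + have [|||||s [us sz sn]] := @exists_coef2_neq0 _ N _ (@root_site_inj R N)
      M1 m n L (acoef R m n); [exact: nm|exact: mM|lia|by []|exact: oner_neq0|].
    by exists s; split; rewrite // -(big_mkord xpredT (fun l =>
      acoef R m n l * ((seq_poly _ s)`_(m + l) * (seq_poly _ s)`_(n - l)))).
  + congr (_ * _); rewrite M2E NE !natrD !natrM (natrB _ mM) (natrB _ (leq_trans nm mM)).
    by rewrite -[M1.+2%:R]natr1 -[M1.+1%:R]natr1; field.
Qed.
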